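(* Let $E$ be a real Banach lattice and let $S$ be a positive, bounded and irreducible $C_0$-semigroup on $E$ with generator $A$, and assume that $S$ is eventually norm continuous. Then precisely one of the following four situations occurs: (i) $\dim(\ker A')=0$; in this case $S(t)f\to0$ as $t\to\infty$ for each $f\in E$. (ii) $\dim(\ker A')=1$ and $\dim(\ker A)=1$; in this case there exist a quasi-interior point $u\in E_+$ and a strictly positive functional $\varphi\in E'$ such that $S(t)f\to\langle\varphi,f\rangle u$ as $t\to\infty$ for each $f\in E$. (iii) $\dim(\ker A')=1$ and $\dim(\ker A)=0$; in this case $S(t)$ does not converge strongly as $t\to\infty$. (iv) $\dim(\ker A')\ge2$; in this case $S(t)$ does not converge strongly as $t\to\infty$.
   Context: A $C_0$-semigroup is a map $S:(0,\infty)\to\mathcal{L}(E)$ with $S(s+t)=S(t)S(s)$, locally bounded near $0$, and $S(t)f\to f$ as $t\downarrow0$ for every $f$; its generator is $Af=\lim_{t\downarrow0}(S(t)f-f)/t$ on the set of $f$ where this limit exists, and $A'$ is its dual (adjoint) operator on $E'$. $S$ is bounded if $\sup_{t>0}\|S(t)\|<\infty$, positive if each $S(t)$ maps $E_+$ into $E_+$, and eventually norm continuous if there is $t_0\ge0$ such that $t\mapsto S(t)$ is continuous in operator norm on $(t_0,\infty)$. A positive semigroup is irreducible if for every $0<f\in E$ and $0<\varphi\in E'$ (where $0<x$ means $x\ge0,x\ne0$) there is $t>0$ with $\langle\varphi,S(t)f\rangle>0$. A vector $u\in E_+$ is a quasi-interior point if $\lim_{n\to\infty}v\wedge(nu)=v$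 for all $v\in E_+$; $\varphi\in E'$ is strictly positive if $\langle\varphi,f\rangle>0$ for all $0<f\in E$. *)

(* Defs.v *)
From HB Require Import structures.
From mathcomp Require Import all_boot all_order all_algebra.
From mathcomp Require Import all_classical all_reals all_analysis.
Set Implicit Arguments. Unset Strict Implicit. Unset Printing Implicit Defensive.
Import Order.TTheory GRing.Theory Num.Theory.
Import numFieldNormedType.Exports.
Local Open Scope ring_scope.
Local Open Scope classical_set_scope.

Record banach_lattice (R : realType) (E : normedModType R) := BanachLattice {
  bl_le : E -> E -> Prop;
  bl_join : E -> E -> E;
  bl_le_refl : forall x, bl_le x x;
  bl_le_anti : forall x y, bl_le x y -> bl_le y x -> x = y;
  bl_le_trans : forall x y z, bl_le x y -> bl_le y z -> bl_le x z;
  bl_le_add : forall x y z, bl_le x y -> bl_le (x + z) (y + z);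
  bl_le_scale : forall (a : R) x y, 0 <= a -> bl_le x y -> bl_le (a *: x) (a *: y);
  bl_join_ubl : forall x y, bl_le x (bl_join x y);
  bl_join_ubr : forall x y, bl_le y (bl_join x y);
  bl_join_lub : forall x y z, bl_le x z -> bl_le y z -> bl_le (bl_join x y) z;
  bl_norm_mono : forall x y,
    bl_le (bl_join x (- x)) (bl_join y (- y)) -> `|x| <= `|y|
}.

Section Defs.
Context {R : realType} {E : normedModType R} (L : banach_lattice E).

Definition bl_meet (x y : E) : E := - bl_join L (- x) (- y).
Definition bl_pos (x : E) : Prop := bl_le L 0 x.
Definition bl_strict_pos (x : E) : Prop := bl_pos x /\ x <> 0.

Definition is_dual (phi : E -> R) : Prop :=
  (forall (a : R) (x y : E), phi (a *: x + y) = a * phi x + phi y) /\ continuous phi.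

Definition dual_pos (phi : E -> R) : Prop := forall f, bl_pos f -> 0 <= phi f.
Definition dual_strict_pos (phi : E -> R) : Prop :=
  dual_pos phi /\ exists f, phi f <> 0.

Definition strictly_positive (phi : E -> R) : Prop :=
  is_dual phi /\ forall f, bl_strict_pos f -> 0 < phi f.

Definition quasi_interior (u : E) : Prop :=
  bl_pos u /\ forall v, bl_pos v -> (fun n : nat => bl_meet v (n%:R *: u)) @ \oo --> v.

(* C0-semigroup S : (0,oo) -> L(E) (values at t <= 0 are irrelevant) *)
Definition C0_semigroup (S : R -> E -> E) : Prop :=
  (forall t, 0 < t -> (forall (a : R) (x y : E), S t (a *: x + y) = a *: S t x + S t y)
                      /\ continuous (S t)) /\
  (forall s t, 0 < s -> 0 < t -> forall f, S (s + t) f = S t (S s f)) /\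
  (exists delta M : R, 0 < delta /\ forall t, 0 < t < delta -> forall f, `|S t f| <= M * `|f|) /\
  (forall f, S^~ f @ 0^'+ --> f).

Definition sg_bounded (S : R -> E -> E) : Prop :=
  exists M : R, forall t, 0 < t -> forall f, `|S t f| <= M * `|f|.

Definition sg_positive (S : R -> E -> E) : Prop :=
  forall t, 0 < t -> forall f, bl_pos f -> bl_pos (S t f).

Definition sg_irreducible (S : R -> E -> E) : Prop :=
  forall f phi, bl_strict_pos f -> is_dual phi -> dual_strict_pos phi ->
    exists t, 0 < t /\ 0 < phi (S t f).

(* continuity in operator norm on (t0, oo), written out:
   ||S s - S t|| <= eps  iff  forall f, |S s f - S t f| <= eps |f| *)
Definition eventually_norm_continuous (S : R -> E -> E) : Prop :=
  exists t0 : R, 0 <= t0 /\ forall t, t0 < t -> forall eps : R, 0 < eps ->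
    exists delta : R, 0 < delta /\ forall s, t0 < s -> `|s - t| < delta ->
      forall f, `|S s f - S t f| <= eps * `|f|.

(* graph of the generator A: f \in D(A) and A f = g *)
Definition generator (S : R -> E -> E) (f g : E) : Prop :=
  (fun t => t^-1 *: (S t f - f)) @ 0^'+ --> g.

Definition ker_gen (S : R -> E -> E) (f : E) : Prop := generator S f 0.

(* kernel of the dual operator A' : phi \in D(A') with A' phi = 0,
   i.e. phi \in E' and <phi, A f> = 0 for all f \in D(A) *)
Definition ker_dual_gen (S : R -> E -> E) (phi : E -> R) : Prop :=
  is_dual phi /\ forall f g, generator S f g -> phi g = 0.

Definition dim0 (K : E -> Prop) : Prop := forall x, K x -> x = 0.
Definition dim1 (K : E -> Prop) : Prop :=
  exists v, K v /\ v <> 0 /\ forall x, K x -> exists c : R, x = c *: v.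

Definition ddim0 (K : (E -> R) -> Prop) : Prop :=
  forall phi, K phi -> forall f, phi f = 0.
Definition ddim1 (K : (E -> R) -> Prop) : Prop :=
  exists psi, K psi /\ (exists f, psi f <> 0) /\
    forall phi, K phi -> exists c : R, forall f, phi f = c * psi f.
Definition ddim_ge2 (K : (E -> R) -> Prop) : Prop :=
  exists phi psi, K phi /\ K psi /\
    forall a b : R, (forall f, a * phi f + b * psi f = 0) -> a = 0 /\ b = 0.

Definition strongly_convergent (S : R -> E -> E) : Prop :=
  forall f, exists g : E, S^~ f @ +oo --> g.

End Defs.

(* Main.v *)
Require Import Defs.
From HB Require Import structures.
From mathcomp Require Import all_boot all_order all_algebra.
From mathcomp Require Import all_classical all_reals all_analysis.
From mathcomp Require Import ring lra.
Import Order.TTheory GRing.Theory Num.Theory.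
Import numFieldNormedType.Exports.
Local Open Scope ring_scope.
Local Open Scope classical_set_scope.
Set Implicit Arguments. Unset Strict Implicit. Unset Printing Implicit Defensive.

(** The heart of the matter is that every bounded complete trajectory
    [X : R -> E'] of the dual semigroup, [X r = X (r + t) \o S t], is constant.
    Such trajectories form a vector lattice, with
    [X^+ r f = sup {X (r + t) g | t > 0, 0 <= g <= S t f}], on which the shifts
    act as a group of positive operators; eventual norm continuity makes the shift
    [U] by a small time, and its inverse, close in norm to the identity.  Hence [U]
    preserves disjointness: if [v] and [z] are disjoint and [0 <= w <= v],
    [w <= U z], then [w] and [U^-1 w] are disjoint, so [|w| <= C |w - U^-1 w|]
    forces [w = 0].  For [X >= 0], [T = lam U] with [lam < 1], [z = (X - T X)^+]
    and [v = (T X - X)^+], the inequality [X <= T X + z] gives [v <= T^n X] for all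
    [n] by induction, so [v = 0]; letting [lam] tend to [1], [U X <= X], and the
    same for [U^-1] gives [U X = X].

    If [S t f] does not tend to [0], then norming functionals [psi_t] at [S t f]
    and an ultrafilter limit of [psi_t \o S (t - r)] along [t -> oo] produce a
    trajectory, hence an invariant functional, which does not vanish at [f].
    So [S t f -> 0] as soon as [f] is annihilated by [ker A'].  Irreducibility
    does the rest: a nonzero [ker A'] contains a strictly positive functional,
    positive fixed vectors are quasi-interior, and [dim (ker A) <= 1]. *)

Section LinearFor.
Context {R : pzRingType} {U : lmodType R} {V : zmodType} {s : GRing.Scale.law R V}.
Variables (f : U -> V) (lin : linear_for s f).
Implicit Types x y : U.

Lemma linear_forB x y : f (x - y) = f x - f y.
Proof. exact: zmod_morphism_linear. Qed.

Lemma linear_for0 : f 0 = 0.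
Proof. by rewrite -[0 in LHS]subr0 linear_forB subrr. Qed.

Lemma linear_forN x : f (- x) = - f x.
Proof. by have := linear_forB 0 x; rewrite linear_for0 !sub0r. Qed.

Lemma linear_forD x y : f (x + y) = f x + f y.
Proof. by have := linear_forB x (- y); rewrite linear_forN !opprK. Qed.

Lemma linear_for_sum (I : Type) (r : seq I) (P : pred I) (F : I -> U) :
  f (\sum_(i <- r | P i) F i) = \sum_(i <- r | P i) f (F i).
Proof. exact: (big_morph f linear_forD linear_for0). Qed.

End LinearFor.

Lemma linear_forZ (R : pzRingType) (U V : lmodType R) (f : U -> V) (a : R) (x : U) :
  linear f -> f (a *: x) = a *: f x.
Proof. by move=> lin; exact: (scalable_linear lin). Qed.

Lemma scalar_forZ (R : pzRingType) (U : lmodType R) (f : U -> R) (a : R) (x : U) :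
  scalar f -> f (a *: x) = a * f x.
Proof. by move=> lin; exact: (scalable_linear lin). Qed.

(** * The Hahn-Banach theorem *)

Section Sublinear.
Context {R : realType} {V : lmodType R}.
Implicit Types (p q : V -> R) (x y : V).

Definition sublinear p : Prop :=
  (forall x y, p (x + y) <= p x + p y) /\
  (forall (a : R) x, 0 < a -> p (a *: x) <= a * p x).

Lemma sublinear0 p : sublinear p -> p 0 = 0.
Proof.
move=> [_ pZ].
have half : p 0 <= 2^-1 * p 0 by rewrite -[in leLHS](scaler0 _ 2^-1); apply: pZ.
have double : p 0 <= 2 * p 0 by rewrite -[in leLHS](scaler0 _ 2); apply: pZ.
lra.
Qed.

Lemma sublinearZ p (a : R) x : sublinear p -> 0 <= a -> p (a *: x) = a * p x.
Proof.
move=> sp; rewrite le_eqVlt => /predU1P[<-|a0].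
  by rewrite scale0r mul0r sublinear0.
apply/eqP; rewrite eq_le sp.2//=.
have := sp.2 a^-1 (a *: x); rewrite invr_gt0 scalerA mulVf ?gt_eqF// scale1r.
by move=> /(_ a0); rewrite ler_pdivlMl.
Qed.

Lemma sublinear_geN p x : sublinear p -> - p (- x) <= p x.
Proof. by move=> sp; have := sp.1 x (- x); rewrite subrr sublinear0//; lra. Qed.

Section InfFun.
Context {I : Type} (A : set I) (F : I -> V -> R).
Hypotheses (A0 : A !=set0)
  (lbF : forall x, exists b, forall i, A i -> b <= F i x)
  (FD : forall i j x y, A i -> A j ->
    exists2 k, A k & F k (x + y) <= F i x + F j y)
  (FZ : forall i (a : R) x, A i -> 0 < a ->
    exists2 k, A k & F k (a *: x) <= a * F i x).

Definition inf_fun x : R := inf [set F i x | i in A].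

Lemma inf_fun_le i x : A i -> inf_fun x <= F i x.
Proof.
move=> Ai; apply: ge_inf; last by exists i.
by have [b bF] := lbF x; exists b => _ [j Aj <-]; exact: bF.
Qed.

Lemma sublinear_inf_fun : sublinear inf_fun.
Proof.
have [i0 Ai0] := A0.
have F0 x : [set F i x | i in A] !=set0 by exists (F i0 x); exists i0.
split=> [x y|a x a0].
- rewrite -lerBlDr; apply: lb_le_inf => // _ [i Ai <-].
  rewrite lerBlDr -lerBlDl; apply: lb_le_inf => // _ [j Aj <-].
  rewrite lerBlDl; have [k Ak Fk] := FD x y Ai Aj.
  exact: le_trans (inf_fun_le _ Ak) Fk.
- rewrite -ler_pdivrMl//; apply: lb_le_inf => // _ [i Ai <-].
  rewrite ler_pdivrMl//; have [k Ak Fk] := FZ x Ai a0.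
  exact: le_trans (inf_fun_le _ Ak) Fk.
Qed.

End InfFun.

Lemma sublinear_lower p y : sublinear p ->
  exists p', [/\ sublinear p', forall x, p' x <= p x & p' (- y) <= - p y].
Proof.
move=> sp; pose F (t : R) x := p (x + t *: y) - t * p y.
have lbF x : exists b, forall t, 0 <= t -> b <= F t x.
  exists (- p (- x)) => t t0; have := sp.1 (- x) (x + t *: y).
  by rewrite addrA addNr add0r sublinearZ// /F; lra.
exists (inf_fun [set t | 0 <= t] F); split.
- apply: sublinear_inf_fun => //; first by exists 0 => /=.
  + move=> s t x z /= s0 t0; exists (s + t); first exact: addr_ge0.
    have := sp.1 (x + s *: y) (z + t *: y).
    by rewrite addrACA -scalerDl /F; lra.
  + move=> s a x /= s0 a0; exists (a * s); first by rewrite mulr_ge0// ltW.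
    by rewrite /F -scalerA -scalerDr sublinearZ ?(ltW a0)// mulrBr mulrA.
- move=> x; apply: le_trans (inf_fun_le (i := 0) lbF x _) _ => //=.
  by rewrite /F scale0r addr0 mul0r subr0.
- apply: le_trans (inf_fun_le (i := 1) lbF (- y) _) _ => //=.
  by rewrite /F scale1r addNr sublinear0// mul1r sub0r.
Qed.

Lemma minimal_sublinear q : sublinear q ->
  exists p, [/\ sublinear p, forall x, p x <= q x &
    forall p', sublinear p' -> (forall x, p' x <= p x) -> forall x, p x <= p' x].
Proof.
move=> sq; pose below p := sublinear p /\ forall x, p x <= q x.
pose top : {p | below p} := exist _ q (conj sq (fun x => lexx (q x))).
pose ge (s t : {p | below p}) := `[< forall x, sval t x <= sval s x >].
have [||A totA|[p [sp pq]] pmin] := @ZL_preorder _ top ge.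
- by move=> t; apply/asboolP.
- move=> s t u /asboolP ts /asboolP us; apply/asboolP => x.
  exact: le_trans (us x) (ts x).
- have [A0|/set0P/negP/negPn/eqP A0] := pselect (A !=set0); last first.
    by exists top => s; rewrite A0.
  have lbA x : exists b, forall t, A t -> b <= sval t x.
    exists (- q (- x)) => -[p [sp pq]] _ /=.
    by apply: le_trans (sublinear_geN x sp); rewrite lerN2.
  have infA : below (inf_fun A (fun t => sval t)).
    split; last first.
      move=> x; have [a Aa] := A0.
      exact: le_trans (inf_fun_le lbA x Aa) ((svalP a).2 x).
    apply: sublinear_inf_fun => // [s t x y As At|s c x As c0]; last first.
      by exists s => //; apply: (svalP s).1.2.
    have [/asboolP ts|/asboolP st] := totA _ _ As At.
      by exists t => //; have := (svalP t).1.1 x y; have := ts x; lra.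
    by exists s => //; have := (svalP s).1.1 x y; have := st y; lra.
  by exists (exist _ _ infA) => s As; apply/asboolP => x; exact: inf_fun_le.
- exists p; split=> // p' sp' p'p.
  have bp' : below p' by split=> // x; exact: le_trans (p'p x) (pq x).
  exact/asboolP/(pmin (exist _ p' bp'))/asboolP.
Qed.

Theorem hahn_banach q v : sublinear q ->
  exists phi : V -> R, [/\ scalar phi, forall x, phi x <= q x & phi v = q v].
Proof.
move=> sq; have [qv [sqv qvq qvN]] := sublinear_lower v sq.
have [p [sp pqv pmin]] := minimal_sublinear sqv.
(* Minimality and [sublinear_lower] make [p] odd, hence linear. *)
have pN y : p (- y) = - p y.
  have [p' [sp' p'p p'y]] := sublinear_lower y sp.
  apply/eqP; rewrite eq_le (le_trans (pmin _ sp' p'p _) p'y)/=.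
  by have := sublinear_geN (- y) sp; rewrite opprK.
have pD x y : p (x + y) = p x + p y.
  apply/eqP; rewrite eq_le sp.1/=.
  by have := sp.1 (x + y) (- y); rewrite addrK pN; lra.
exists p; split=> [a x y|x|].
- rewrite pD; congr (_ + _); have [a0|a0] := leP 0 a; first exact: sublinearZ.
  have := @sublinearZ p (- a) x sp; rewrite oppr_ge0 (ltW a0) => /(_ isT).
  by rewrite scaleNr pN mulNr => /oppr_inj.
- exact: le_trans (pqv x) (qvq x).
- apply/eqP; rewrite eq_le (le_trans (pqv v) (qvq v))/=.
  by have := le_trans (pqv (- v)) qvN; rewrite pN lerN2.
Qed.

End Sublinear.

Section Dual.
Context {R : realType} {E : normedModType R}.
Implicit Types (phi : E -> R) (x y : E).

Lemma is_dual_lipschitz phi : is_dual phi ->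
  exists2 c, 0 < c & forall x, `|phi x| <= c * `|x|.
Proof.
move=> [lin cont].
pose phil : {linear E -> R^o} := HB.pack phi (GRing.isLinear.Build _ _ _ _ phi lin).
exact: (@linear_lipschitz _ _ _ phil).
Qed.

Lemma bounded_is_dual phi (c : R) : scalar phi ->
  (forall x, `|phi x| <= c * `|x|) -> is_dual phi.
Proof.
move=> lin phic; split=> //.
pose phil : {linear E -> R^o} := HB.pack phi (GRing.isLinear.Build _ _ _ _ phi lin).
apply: (@bounded_linear_continuous _ _ _ phil); apply/linear_boundedP.
near=> r => x; apply: le_trans (phic x) _; rewrite ler_wpM2r//; near: r.
Unshelve. all: by end_near. Qed.

Lemma is_dual_comp phi (T : E -> E) :
  is_dual phi -> linear T -> continuous T -> is_dual (phi \o T).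
Proof.
move=> [lin cont] linT contT; split=> [a x y|x] /=; first by rewrite linT lin.
by apply: continuous_comp; [exact: contT|exact: cont].
Qed.

Lemma norming_functional x : exists phi,
  [/\ is_dual phi, forall y, `|phi y| <= `|y| & phi x = `|x|].
Proof.
have sn : sublinear (fun y : E => `|y|).
  split=> [y z|a y a0]; first exact: ler_normD.
  by rewrite normrZ gtr0_norm.
have [phi [lin le phix]] := hahn_banach x sn.
have phi1 y : `|phi y| <= `|y|.
  rewrite ler_norml le andbT.
  by have := le (- y); rewrite (linear_forN lin) normrN; lra.
by exists phi; split=> //; apply: (@bounded_is_dual _ 1) => // y; rewrite mul1r.
Qed.

Lemma dual_separates x y : (forall phi, is_dual phi -> phi x = phi y) -> x = y.
Proof.
move=> phixy; have [phi [dphi _ phin]] := norming_functional (x - y).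
apply/eqP; rewrite -subr_eq0 -normr_eq0 -phin (linear_forB dphi.1).
by rewrite phixy// subrr.
Qed.

End Dual.

Lemma geometric_le0 (R : realType) (q C x : R) : 0 <= q < 1 ->
  (forall n, x <= C * q ^+ n) -> x <= 0.
Proof.
move=> /andP[q0 q1] xC; have q1' : `|q| < 1 by rewrite ger0_norm.
by apply: (cvgr_to_ge (cvg_geometric C q1')); exact: nearW.
Qed.

Lemma near_divr_nat_lt (R : realType) (x d : R) : 0 < d ->
  \forall n \near \oo, (0 < n)%N /\ x / n%:R < d.
Proof.
move=> d0; near=> n; have n0 : (0 < n)%N by near: n; exists 1%N.
split=> //; rewrite ltr_pdivrMr ?ltr0n// mulrC -ltr_pdivrMr//.
by near: n; exact: nbhs_infty_gtr.
Unshelve. all: by end_near. Qed.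

(** * Weak integrals of Banach space valued functions *)

Lemma continuous_primitive (R : realType) (g : R -> R) (a b : R) : continuous g ->
  exists G : R -> R, forall x, a <= x <= b -> is_derive x 1 G (g x).
Proof.
move=> cg; pose G x := (\int[lebesgue_measure]_(t in `[(a - 1)%R, x]) g t)%R.
exists G => x /andP[ax xb].
have intg : lebesgue_measure.-integrable `[a - 1, b + 1] (EFin \o g).
  apply: continuous_compact_integrable; first exact: segment_compact.
  exact: continuous_subspaceT.
have xb1 : x < b + 1 by lra.
have ax1 : a - 1 < x by lra.
have [dG G'x] := continuous_FTC1_closed xb1 intg ax1 (cg x).
by split; [exact: dG|rewrite -derive1E].
Qed.

Lemma increment_approx (R : realType) (g G : R -> R) (x h e : R) : 0 <= h ->
  (forall y, x <= y <= x + h -> is_derive y 1 G (g y)) ->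
  (forall y, x <= y <= x + h -> `|g y - g x| <= e) ->
  `|G (x + h) - G x - h * g x| <= h * e.
Proof.
move=> h0 dG ge; have sub y : y \in `]x, (x + h)[%R -> x <= y <= x + h.
  by rewrite in_itv/= => /andP[/ltW -> /ltW ->].
have [|||c] := @MVT_segment R G g x (x + h).
- by rewrite lerDl.
- by move=> y /sub; exact: dG.
- apply: derivable_within_continuous => y; rewrite in_itv/= => xyh.
  by have [] := dG y xyh.
rewrite in_itv/= [x + h]addrC addrK => xch ->; rewrite [h + x]addrC in xch.
rewrite [_ * h]mulrC -mulrBr normrM ger0_norm//.
by rewrite ler_wpM2l// ge.
Qed.

Lemma riemann_sum_primitive (R : realType) (g G : R -> R) (a h e : R) (n : nat) :
  0 <= h -> (forall x, a <= x <= a + n%:R * h -> is_derive x 1 G (g x)) ->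
  (forall x y, `|x - y| <= h -> `|g x - g y| <= e) ->
  `|G (a + n%:R * h) - G a - \sum_(k < n) h * g (a + k%:R * h)| <= n%:R * h * e.
Proof.
move=> h0 dG ge; pose x (k : nat) := a + k%:R * h.
have xS k : x k.+1 = x k + h by rewrite /x -natr1 mulrDl mul1r addrA.
have x_le k l : (k <= l)%N -> x k <= x l.
  by move=> kl; rewrite lerD2l ler_wpM2r// ler_nat.
have x0 : x 0 = a by rewrite /x mul0r addr0.
rewrite -/(x n) -{1}x0 -(telescope_sumr (G \o x))// big_mkord -sumrB.
apply: le_trans (ler_norm_sum _ _ _) _.
rewrite -mulrA mulr_natl -[X in _ <= _ *+ X]card_ord -sumr_const.
apply: ler_sum => k _ /=; rewrite xS; apply: increment_approx => // y /andP[xy yx].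
  apply: dG; rewrite -{1}x0 (le_trans (x_le 0 k _) xy)//=.
  by apply: le_trans yx _; rewrite -xS; apply: x_le.
by apply: ge; rewrite ger0_norm ?subr_ge0// lerBlDl.
Qed.

Section WeakIntegral.
Context {R : realType} {E : completeNormedModType R}.
Implicit Types (u : R -> E) (a b h e : R) (v w : E).

(* Stated with primitives of [phi \o u], which makes concatenation and translation
   of the interval immediate. *)
Definition weak_integral u a b w : Prop :=
  forall phi, is_dual phi -> forall G : R -> R,
  (forall x, a <= x <= b -> is_derive x 1 G (phi (u x))) -> phi w = G b - G a.

Definition riemann_sum u a b (n : nat) : E :=
  let h := (b - a) / n%:R in \sum_(k < n) h *: u (a + k%:R * h).

Lemma unif_continuous_normP u : unif_continuous u <->
  forall e, 0 < e ->
    exists2 d, 0 < d & forall x y, `|x - y| < d -> `|u x - u y| < e.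
Proof.
split=> [/unif_continuousP cu|cu]; last apply/unif_continuousP.
  move=> e /cu[d d0 ud]; exists d => // x y xy.
  by have := ud (x, y); rewrite -!ball_normE; exact.
move=> e /cu[d d0 ud]; exists d => // -[x y].
by rewrite -!ball_normE; exact: ud.
Qed.

Lemma unif_continuous_continuous u : unif_continuous u -> continuous u.
Proof.
move=> /unif_continuous_normP cu x; apply/cvgrPdist_lt => e e0.
have [d d0 ud] := cu e e0; near=> y; apply: ud.
by near: y; exact: cvgr_dist_lt.
Unshelve. all: by end_near. Qed.

Lemma continuous_dual_primitive u a b phi : continuous u -> is_dual phi ->
  exists G : R -> R, forall x, a <= x <= b -> is_derive x 1 G (phi (u x)).
Proof.
move=> cu [_ cphi]; apply: (continuous_primitive (g := phi \o u)) => x.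
by apply: continuous_comp; [exact: cu|exact: cphi].
Qed.

Lemma weak_integral_unique u a b v w : continuous u ->
  weak_integral u a b v -> weak_integral u a b w -> v = w.
Proof.
move=> cu uv uw; apply: dual_separates => phi dphi.
have [G dG] := continuous_dual_primitive a b cu dphi.
by rewrite (uv phi dphi G dG) (uw phi dphi G dG).
Qed.

Lemma weak_integral_cat u a b c v w : a <= b <= c ->
  weak_integral u a b v -> weak_integral u b c w -> weak_integral u a c (v + w).
Proof.
move=> /andP[ab bc] uv uw phi dphi G dG; rewrite (linear_forD dphi.1).
have -> : phi v = G b - G a.
  by apply: uv => // x /andP[ax xb]; apply: dG; rewrite ax (le_trans xb).
have -> : phi w = G c - G b.
  by apply: uw => // x /andP[bx xc]; apply: dG; rewrite xc (le_trans ab).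
by rewrite addrC subrKA.
Qed.

Lemma weak_integral_map u1 u2 a b h w (T : E -> E) : linear T -> continuous T ->
  (forall x, a <= x <= b -> T (u1 x) = u2 (x + h)) ->
  weak_integral u1 a b w -> weak_integral u2 (a + h) (b + h) (T w).
Proof.
move=> linT contT Tu uw phi dphi G dG.
apply: (uw _ (is_dual_comp dphi linT contT) (fun x => G (x + h))) => x xab.
rewrite /= Tu// -[phi _]mulr1.
apply: (@is_derive1_comp R G (shift h)); last exact: is_derive_shift.
by apply: dG; rewrite !lerD2r.
Qed.

Lemma weak_integral_approx u a h e w : continuous u -> 0 <= h ->
  (forall x, a <= x <= a + h -> `|u x - u a| <= e) ->
  weak_integral u a (a + h) w -> `|w - h *: u a| <= h * e.
Proof.
move=> cu h0 ue uw; have [phi [dphi phi1 <-]] := norming_functional (w - h *: u a).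
have [G dG] := continuous_dual_primitive a (a + h) cu dphi.
rewrite (linear_forB dphi.1) (scalar_forZ _ _ dphi.1) (uw phi dphi G dG).
apply: le_trans (ler_norm _) _; apply: (increment_approx h0 dG) => x xah /=.
by rewrite -(linear_forB dphi.1); apply: le_trans (phi1 _) (ue _ xah).
Qed.

Lemma riemann_sum_weak_approx u a b d e c phi (G : R -> R) n : a <= b -> (0 < n)%N ->
  (b - a) / n%:R < d -> (forall x y, `|x - y| < d -> `|u x - u y| < e) ->
  scalar phi -> 0 <= c -> (forall x, `|phi x| <= c * `|x|) ->
  (forall x, a <= x <= b -> is_derive x 1 G (phi (u x))) ->
  `|G b - G a - phi (riemann_sum u a b n)| <= (b - a) * (c * e).
Proof.
move=> ab n0 hd ud lin c0 phic dG; set h := (b - a) / n%:R in hd.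
have nh : n%:R * h = b - a by rewrite mulrC mulfVK// pnatr_eq0 -lt0n.
have ahb : a + n%:R * h = b by rewrite nh addrC subrK.
rewrite -{1}nh -{1}ahb (linear_for_sum lin).
under eq_bigr do rewrite (scalar_forZ _ _ lin).
apply: (@riemann_sum_primitive _ (phi \o u)) => [||x y xy].
- by rewrite divr_ge0// subr_ge0.
- by rewrite ahb.
rewrite -(linear_forB lin); apply: le_trans (phic _) _.
by rewrite ler_wpM2l// ltW// ud// (le_lt_trans xy).
Qed.

Lemma riemann_sum_cvg u a b : a <= b -> unif_continuous u ->
  cvg (riemann_sum u a b n @[n --> \oo]).
Proof.
move=> ab ucu; have cu := unif_continuous_continuous ucu.
apply/cauchy_cvgP/cauchy_exP => e e0.
pose e' := e / (2 * (b - a) + 1); have ba0 : 0 < 2 * (b - a) + 1 by lra.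
have [d d0 ud] := (unif_continuous_normP u).1 ucu e' (divr_gt0 e0 ba0).
have [N _ fine] := near_divr_nat_lt (b - a) d0; have [N0 Nd] := fine N (leqnn N).
exists (riemann_sum u a b N), N => // n /fine[n0 nd]; rewrite -ball_normE /=.
(* A norming functional reduces the estimate to scalar Riemann sums, which are
   compared with the increment of a common primitive. *)
have [phi [dphi phi1 <-]] :=
  norming_functional (riemann_sum u a b N - riemann_sum u a b n).
have [G dG] := continuous_dual_primitive a b cu dphi.
have approx m : (0 < m)%N -> (b - a) / m%:R < d ->
    `|G b - G a - phi (riemann_sum u a b m)| <= (b - a) * e'.
  move=> m0 md; rewrite -[e' in leRHS]mul1r.
  by apply: (riemann_sum_weak_approx ab m0 md ud dphi.1) => // x; rewrite mul1r.
have := approx N N0 Nd; have := approx n n0 nd; rewrite !ler_norml => ? ?.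
rewrite (linear_forB dphi.1).
apply: (@le_lt_trans _ _ (2 * (b - a) * e')); first by lra.
by rewrite /e' mulrCA gtr_pMr// ltr_pdivrMr// mul1r ltrDl.
Qed.

Lemma unif_continuous_weak_integral u a b : a <= b -> unif_continuous u ->
  exists w, weak_integral u a b w.
Proof.
move=> ab ucu; have /cvg_ex[w sumw] := riemann_sum_cvg ab ucu.
exists w => phi dphi G dG; have [c c0 phic] := is_dual_lipschitz dphi.
apply: (@cvg_unique _ (@norm_hausdorff _ R^o)
  (phi (riemann_sum u a b n) @[n --> \oo])).
  exact: continuous_cvg (dphi.2 w) sumw.
apply/cvgrPdist_le => e e0; pose e' := e / ((b - a) * c + 1).
have bac0 : 0 < (b - a) * c + 1 by rewrite ltr_pwDr// mulr_ge0 ?subr_ge0// ltW.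
have [d d0 ud] := (unif_continuous_normP u).1 ucu e' (divr_gt0 e0 bac0).
have e'e : (b - a) * (c * e') <= e.
  by rewrite mulrA mulrCA ger_pMr// ler_pdivrMr// mul1r lerDl.
near=> n; have [n0 nd] : (0 < n)%N /\ (b - a) / n%:R < d.
  by near: n; exact: near_divr_nat_lt.
exact: le_trans (riemann_sum_weak_approx ab n0 nd ud dphi.1 (ltW c0) phic dG) e'e.
Unshelve. all: by end_near. Qed.

End WeakIntegral.

(** * Vector lattices *)

Section BanachLattice.
Context {R : realType} {E : normedModType R} (L : banach_lattice E).
Implicit Types (a : R) (n : nat) (u v w x y z : E).
Local Notation pos := (bl_pos L).
Local Notation le := (bl_le L).

Lemma bl_subr_pos x y : pos (y - x) <-> le x y.
Proof.
split=> h; first by have := bl_le_add x h; rewrite add0r subrK.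
by have := bl_le_add (- x) h; rewrite subrr.
Qed.

Lemma bl_leBlDr x y z : le (x - y) z <-> le x (z + y).
Proof. by rewrite -!bl_subr_pos opprB addrA. Qed.

Lemma bl_leD x y z w : le x y -> le z w -> le (x + z) (y + w).
Proof.
move=> xy zw; apply: bl_le_trans (bl_le_add z xy) _.
by rewrite ![y + _]addrC; exact: bl_le_add.
Qed.

Lemma bl_pos0 : pos 0.
Proof. exact: bl_le_refl. Qed.

Lemma bl_posD x y : pos x -> pos y -> pos (x + y).
Proof. by move=> x0 y0; rewrite /bl_pos -[0]addr0; exact: bl_leD. Qed.

Lemma bl_posZ a x : 0 <= a -> pos x -> pos (a *: x).
Proof. by move=> a0 x0; have := bl_le_scale a0 x0; rewrite scaler0. Qed.

Lemma bl_leZ_natS n x : pos x -> le (n%:R *: x) (n.+1%:R *: x).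
Proof.
move=> x0; apply/bl_subr_pos.
by rewrite -scalerBl -natr1 [n%:R + 1]addrC addrK scale1r.
Qed.

Lemma bl_pos_half x : pos (x + x) -> pos x.
Proof.
move=> xx; have -> : x = 2^-1 *: (x + x).
  by rewrite scalerDr -scalerDl -[2^-1]div1r -splitr scale1r.
by apply: bl_posZ => //; rewrite invr_ge0.
Qed.

Definition pospart x : E := bl_join L x 0.

Lemma pospart_pos x : pos (pospart x).
Proof. exact: bl_join_ubr. Qed.

Lemma pospart_ge x : le x (pospart x).
Proof. exact: bl_join_ubl. Qed.

Lemma pospart_least x y : pos y -> le x y -> le (pospart x) y.
Proof. by move=> y0 xy; exact: bl_join_lub. Qed.

Lemma pospart_id x : pos x -> pospart x = x.
Proof.
move=> x0; apply: (bl_le_anti (b := L)); last exact: pospart_ge.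
by apply: pospart_least => //; exact: bl_le_refl.
Qed.

Lemma pospart_mono x y : le x y -> le (pospart x) (pospart y).
Proof.
move=> xy; apply: pospart_least; first exact: pospart_pos.
exact: bl_le_trans xy (pospart_ge y).
Qed.

Lemma pospartN x : pospart (- x) = pospart x - x.
Proof.
apply: (bl_le_anti (b := L)).
  apply: pospart_least; first exact/bl_subr_pos/pospart_ge.
  by apply/bl_subr_pos; rewrite opprK subrK; exact: pospart_pos.
apply/bl_leBlDr/pospart_least.
  by have /bl_subr_pos := pospart_ge (- x); rewrite opprK.
by apply/bl_subr_pos; rewrite addrK; exact: pospart_pos.
Qed.

Lemma pospart_decomp x : x = pospart x - pospart (- x).
Proof. by rewrite pospartN opprB addrC subrK. Qed.

Lemma bl_meetE x y : bl_meet L x y = x - pospart (x - y).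
Proof.
rewrite /bl_meet -[RHS]opprK; congr (- _); rewrite opprB.
apply: (bl_le_anti (b := L)).
  apply: bl_join_lub; apply/bl_subr_pos.
    by rewrite opprK subrK; exact: pospart_pos.
  have /bl_subr_pos := pospart_ge (x - y).
  by rewrite opprB [y - x]addrC addrA opprK.
apply/bl_leBlDr/pospart_least.
  by have /bl_subr_pos := bl_join_ubl L (- x) (- y); rewrite opprK.
by rewrite addrC; apply: bl_leD (bl_join_ubr _ _ _) (bl_le_refl _ _).
Qed.

Lemma riesz_decomposition w x y : pos x -> pos y -> pos w -> le w (x + y) ->
  exists w1 w2, [/\ w = w1 + w2, pos w1, pos w2, le w1 x & le w2 y].
Proof.
move=> x0 y0 w0 wxy; exists (w - pospart (w - x)), (pospart (w - x)).
split; first by rewrite subrK.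
- apply/bl_subr_pos/pospart_least => //; apply/bl_subr_pos.
  by rewrite opprB addrC subrK.
- exact: pospart_pos.
- by apply/bl_leBlDr; rewrite addrC; apply/bl_leBlDr/pospart_ge.
- by apply: pospart_least => //; apply/bl_leBlDr; rewrite addrC.
Qed.

Definition bl_disjoint x y : Prop :=
  forall w, pos w -> le w x -> le w y -> w = 0.

Lemma pospart_disjoint x : bl_disjoint (pospart x) (pospart (- x)).
Proof.
move=> w w0 wx wNx; apply: (bl_le_anti (b := L)) => //.
have : le (pospart x) (pospart x - w).
  apply: pospart_least; first exact/bl_subr_pos.
  by move: wNx => /bl_subr_pos; rewrite pospartN addrAC => /bl_subr_pos.
by move=> /bl_subr_pos; rewrite addrAC subrr => /bl_subr_pos.
Qed.

Lemma bl_disjoint_natmul x y n : pos y -> bl_disjoint x y ->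
  bl_disjoint x (n%:R *: y).
Proof.
move=> y0 xy w w0 wx wy; have k0 : 0 < n.+1%:R^-1 :> R by rewrite invr_gt0.
have kw : le (n.+1%:R^-1 *: w) w.
  apply/bl_subr_pos; rewrite -[X in X - _]scale1r -scalerBl.
  by apply: bl_posZ => //; rewrite subr_ge0 invf_le1// ler1n.
suff /eqP : n.+1%:R^-1 *: w = 0 by rewrite scaler_eq0 gt_eqF//= => /eqP.
apply: xy; first exact: bl_posZ (ltW k0) w0.
- exact: bl_le_trans kw wx.
- have := bl_le_scale (ltW k0) (bl_le_trans wy (bl_leZ_natS n y0)).
  by rewrite scalerA mulVf ?scale1r// pnatr_eq0.
Qed.

Lemma bl_disjoint_meet x y : pos x -> pos y -> bl_disjoint x y -> bl_meet L x y = 0.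
Proof.
move=> x0 y0; rewrite bl_meetE; apply.
- apply/bl_subr_pos/pospart_least => //; apply/bl_leBlDr/bl_subr_pos.
  by rewrite addrAC subrr add0r.
- by apply/bl_subr_pos; rewrite opprB addrC subrK; exact: pospart_pos.
- by apply/bl_leBlDr; rewrite addrC; apply/bl_leBlDr/pospart_ge.
Qed.

Lemma quasi_interior_disjoint_eq0 u v : quasi_interior L u -> pos v ->
  bl_disjoint v u -> v = 0.
Proof.
move=> [u0 /(_ v)] uv v0 vu; move: (uv v0).
have -> : (fun n : nat => bl_meet L v (n%:R *: u)) = fun=> 0.
  apply/funext => n; have nu0 : pos (n%:R *: u) by exact: bl_posZ.
  exact: bl_disjoint_meet v0 nu0 (bl_disjoint_natmul u0 vu).
by move=> cv; exact: (cvg_unique (@norm_hausdorff _ E) cv (cvg_cst 0)).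
Qed.

Lemma bl_abs_pos x : pos (bl_join L x (- x)).
Proof.
apply: bl_pos_half; rewrite /bl_pos -(subrr x).
exact: bl_leD (bl_join_ubl _ _ _) (bl_join_ubr _ _ _).
Qed.

Lemma bl_abs_id x : pos x -> bl_join L x (- x) = x.
Proof.
move=> x0; apply: (bl_le_anti (b := L)); last exact: bl_join_ubl.
apply: bl_join_lub; first exact: bl_le_refl.
by apply/bl_subr_pos; rewrite opprK; exact: bl_posD.
Qed.

Lemma bl_norm_le x y : pos x -> le x y -> `|x| <= `|y|.
Proof.
move=> x0 xy; apply: (bl_norm_mono (b := L)).
by rewrite !bl_abs_id//; exact: bl_le_trans xy.
Qed.

Lemma norm_pospart_le x y : pos y -> le x y -> `|pospart x| <= `|y|.
Proof.
by move=> y0 xy; apply: bl_norm_le; [exact: pospart_pos|exact: pospart_least].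
Qed.

Lemma norm_pospart x : `|pospart x| <= `|x|.
Proof.
apply: le_trans (norm_pospart_le (bl_abs_pos x) (bl_join_ubl _ _ _)) _.
apply: (bl_norm_mono (b := L)).
by rewrite (bl_abs_id (bl_abs_pos x)); exact: bl_le_refl.
Qed.

End BanachLattice.

Section QuasiInteriorCriterion.
Context {R : realType} {E : normedModType R} (L : banach_lattice E).
Variable u : E.
Hypothesis u0 : bl_pos L u.
Implicit Types (s t : R) (v x y : E).
Local Notation pos := (bl_pos L).
Local Notation norm_over := (fun s x => `|pospart L (x - s *: u)|).

Definition excess x : R := inf_fun [set s : R | 0 <= s] norm_over x.

Lemma excess_le s x : 0 <= s -> excess x <= norm_over s x.
Proof.
by move=> s0; apply: (@inf_fun_le _ _ _ _ norm_over) => // y; exists 0.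
Qed.

Lemma excess_le_norm x : excess x <= `|pospart L x|.
Proof. by have := excess_le x (lexx 0); rewrite scale0r subr0. Qed.

Lemma sublinear_excess : sublinear excess.
Proof.
apply: sublinear_inf_fun; first by exists 0 => /=.
- by move=> x; exists 0.
- move=> s t x y /= s0 t0; exists (s + t); first exact: addr_ge0.
  apply: le_trans (ler_normD _ _); apply: norm_pospart_le.
    by apply: bl_posD; exact: pospart_pos.
  by rewrite scalerDl opprD addrACA; apply: bl_leD; exact: pospart_ge.
- move=> s a x /= s0 a0; exists (a * s); first by rewrite mulr_ge0// ltW.
  have -> : a * norm_over s x = `|a *: pospart L (x - s *: u)|.
    by rewrite normrZ gtr0_norm.
  rewrite -scalerA -scalerBr; apply: norm_pospart_le.
    exact: bl_posZ (ltW a0) (pospart_pos _ _).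
  exact: bl_le_scale (ltW a0) (pospart_ge _ _).
Qed.

Lemma excess_meet_cvg v : excess v = 0 ->
  (fun n : nat => bl_meet L v (n%:R *: u)) @ \oo --> v.
Proof.
move=> ev0; apply/cvgrPdist_le => e e0.
have [_ [s /= s0 <-]] : exists2 y, [set norm_over s v | s in [set s | 0 <= s]] y &
    y < excess v + e.
  apply: inf_adherent => //; split; first by exists (norm_over 0 v); exists 0 => /=.
  by exists 0 => _ [s _ <-].
rewrite ev0 add0r => se; near=> n.
rewrite bl_meetE opprB addrC subrK; apply: le_trans (ltW se).
apply: bl_norm_le; first exact: pospart_pos.
apply/pospart_mono/bl_subr_pos; rewrite opprB addrC subrKA -scalerBl.
apply: bl_posZ => //; rewrite subr_ge0.
by near: n; exact: nbhs_infty_ger.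
Unshelve. all: by end_near. Qed.

Lemma quasi_interior_of_dual :
  (forall phi, is_dual phi -> dual_strict_pos L phi -> 0 < phi u) ->
  quasi_interior L u.
Proof.
move=> strict; split=> // v v0; apply: excess_meet_cvg.
have [phi [lin phi_le <-]] := hahn_banach v sublinear_excess.
have phi_pos : dual_pos L phi.
  move=> f f0; have := le_trans (phi_le (- f)) (excess_le_norm (- f)).
  by rewrite (linear_forN lin) pospartN pospart_id// subrr normr0; lra.
have dphi : is_dual phi.
  apply: (@bounded_is_dual _ _ _ 1) => // x; rewrite mul1r ler_norml.
  have phi1 y : phi y <= `|y|.
    exact: le_trans (le_trans (phi_le y) (excess_le_norm y)) (norm_pospart L y).
  by have := phi1 x; have := phi1 (- x); rewrite normrN (linear_forN lin); lra.
have phiu : phi u <= 0.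
  apply: le_trans (phi_le u) _; apply: le_trans (excess_le u ler01) _.
  by rewrite scale1r subrr pospart_id ?normr0//; exact: bl_pos0.
apply: contrapT => phiv.
have phi_strict : dual_strict_pos L phi by split=> //; exists v.
by have := strict _ dphi phi_strict; lra.
Qed.

End QuasiInteriorCriterion.

Section ConeExtension.
Context {R : realType} {E : normedModType R} (L : banach_lattice E).
Variable s : E -> R.
Local Notation pos := (bl_pos L).
Implicit Types (a : R) (x y : E).
Hypotheses (sD : forall x y, pos x -> pos y -> s (x + y) = s x + s y)
  (sZ : forall a x, 0 < a -> pos x -> s (a *: x) = a * s x).

Definition cone_extend x : R := s (pospart L x) - s (pospart L (- x)).

Lemma cone_extendB x y : pos x -> pos y -> cone_extend (x - y) = s x - s y.
Proof.
move=> x0 y0; rewrite /cone_extend.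
have e : pospart L (x - y) + y = pospart L (- (x - y)) + x.
  by rewrite pospartN -addrA; congr (_ + _); rewrite opprB subrK.
have := sD (pospart_pos L (x - y)) y0.
by rewrite e (sD (pospart_pos _ _) x0); lra.
Qed.

Lemma cone_extend_id x : pos x -> cone_extend x = s x.
Proof.
move=> x0; have s0 : s 0 = 0.
  by have := sD (bl_pos0 L) (bl_pos0 L); rewrite addr0; lra.
by rewrite -{1}(subr0 x) (cone_extendB x0 (bl_pos0 L)) s0 subr0.
Qed.

Lemma cone_extendD x y : cone_extend (x + y) = cone_extend x + cone_extend y.
Proof.
rewrite {1}(pospart_decomp L x) {1}(pospart_decomp L y) addrACA -opprD.
have posD z z' := bl_posD (pospart_pos L z) (pospart_pos L z').
rewrite (cone_extendB (posD _ _) (posD _ _)) !sD; try exact: pospart_pos.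
by rewrite /cone_extend; ring.
Qed.

Lemma cone_extendN x : cone_extend (- x) = - cone_extend x.
Proof. by rewrite /cone_extend opprK opprB. Qed.

Lemma cone_extendZ_gt0 a x : 0 < a -> cone_extend (a *: x) = a * cone_extend x.
Proof.
move=> a0; rewrite {1}(pospart_decomp L x) scalerBr.
have posZ z := bl_posZ (ltW a0) (pospart_pos L z).
by rewrite (cone_extendB (posZ _) (posZ _)) !sZ ?mulrBr//; exact: pospart_pos.
Qed.

Lemma scalar_cone_extend : scalar cone_extend.
Proof.
move=> a x y; rewrite cone_extendD; congr (_ + _).
have [a0|a0|->] := ltgtP a 0.
- rewrite -[a]opprK scaleNr cone_extendN cone_extendZ_gt0 ?oppr_gt0//.
  by rewrite !mulNr.
- exact: cone_extendZ_gt0.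
- by have := cone_extendD 0 0; rewrite scale0r mul0r addr0; lra.
Qed.

Lemma cone_extend_bounded c x : 0 <= c ->
  (forall y, pos y -> 0 <= s y <= c * `|y|) -> `|cone_extend x| <= c * `|x|.
Proof.
move=> c0 sc; have part y : 0 <= s (pospart L y) <= c * `|y|.
  have /andP[-> spc]/= := sc _ (pospart_pos L y).
  by apply: le_trans spc _; rewrite ler_wpM2l// norm_pospart.
have /andP[p0 pc] := part x; have := part (- x); rewrite normrN => /andP[n0 nc].
by rewrite /cone_extend ler_norml; lra.
Qed.

End ConeExtension.

(** * Bounded complete trajectories of the dual semigroup *)

Section PointwiseOperations.
Context {R : realType} {T1 T2 : Type}.
Implicit Types (f g : T1 -> T2 -> R) (x : T1) (y : T2).

Lemma subr_fun2E f g x y : (f - g) x y = f x y - g x y. Proof. by []. Qed.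

Lemma addr_fun2E f g x y : (f + g) x y = f x y + g x y. Proof. by []. Qed.

Lemma scaler_fun2E (a : R) f x y : (a *: f) x y = a * f x y. Proof. by []. Qed.

Lemma zero_fun2E x y : (0 : T1 -> T2 -> R) x y = 0. Proof. by []. Qed.

End PointwiseOperations.

Local Notation fun2E := (subr_fun2E, addr_fun2E, scaler_fun2E, zero_fun2E).

Definition operator_semigroup (R : realType) (E : normedModType R)
  (S : R -> E -> E) : Prop :=
  (forall t, 0 < t -> linear (S t)) /\
  (forall s t, 0 < s -> 0 < t -> forall f, S (s + t) f = S t (S s f)).

Definition sg_bound (R : realType) (E : normedModType R) (S : R -> E -> E) (M : R)
  : Prop := forall t, 0 < t -> forall f, `|S t f| <= M * `|f|.

Section Trajectories.
Context {R : realType} {E : normedModType R} (L : banach_lattice E).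
Variables (S : R -> E -> E) (M : R).
Hypotheses (semigS : operator_semigroup S) (posS : sg_positive L S)
  (M0 : 0 < M) (SM : sg_bound S M).
Local Notation pos := (bl_pos L).
Local Notation le := (bl_le L).
Implicit Types (X Y Z V W : R -> E -> R) (a c h r s t : R) (f g : E).

Let linS t : 0 < t -> linear (S t). Proof. exact: semigS.1. Qed.

Let mulS s t f : 0 < s -> 0 < t -> S (s + t) f = S t (S s f).
Proof. by move=> s0 t0; exact: semigS.2. Qed.

Lemma sg_mono t f g : 0 < t -> le f g -> le (S t f) (S t g).
Proof.
move=> t0 /bl_subr_pos fg; apply/bl_subr_pos.
by rewrite -(linear_forB (linS t0)); exact: posS.
Qed.

Definition tbounded c X : Prop := forall r f, `|X r f| <= c * `|f|.

Definition trajectory X : Prop :=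
  [/\ forall r, scalar (X r), exists c, tbounded c X &
      forall r t f, 0 < t -> X (r + t) (S t f) = X r f].

Definition tle X Y : Prop := forall r f, pos f -> X r f <= Y r f.

Definition tpos X : Prop := tle 0 X.

Definition tshift h X : R -> E -> R := fun r f => X (r + h) f.

Lemma trajectory_bounded X : trajectory X -> exists2 c, 0 <= c & tbounded c X.
Proof.
move=> [_ [c Xc] _]; exists `|c| => // r f.
by apply: le_trans (Xc r f) _; rewrite ler_wpM2r// ler_norm.
Qed.

Lemma trajectoryZ a X : trajectory X -> trajectory (a *: X).
Proof.
move=> [linX [c Xc] XS]; split=> [r k x y||r t f t0].
- by rewrite !fun2E linX mulrDr mulrCA.
- by exists (`|a| * c) => r f; rewrite fun2E normrM -mulrA ler_wpM2l.
- by rewrite !fun2E XS.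
Qed.

Lemma trajectoryB X Y : trajectory X -> trajectory Y -> trajectory (X - Y).
Proof.
move=> [linX [c Xc] XS] [linY [d Yd] YS]; split=> [r k x y||r t f t0].
- by rewrite !fun2E linX linY; ring.
- exists (c + d) => r f; rewrite !fun2E mulrDl.
  exact: le_trans (ler_normB _ _) (lerD (Xc r f) (Yd r f)).
- by rewrite !fun2E XS ?YS.
Qed.

Lemma trajectory_tshift h X : trajectory X -> trajectory (tshift h X).
Proof.
move=> [linX [c Xc] XS]; split=> [r||r t f t0]; first exact: linX.
  by exists c => r f; exact: Xc.
by rewrite /tshift addrAC XS.
Qed.

Lemma tpos_subr X Y : tpos (Y - X) <-> tle X Y.
Proof.
by split=> XY r f f0; have := XY r f f0; rewrite !fun2E /= subr_ge0.
Qed.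

Lemma trajectory_eq X Y : trajectory X -> trajectory Y ->
  tle X Y -> tle Y X -> X = Y.
Proof.
move=> [linX _ _] [linY _ _] XY YX; apply/funext => r; apply/funext => f.
rewrite (pospart_decomp L f) (linear_forB (linX r)) (linear_forB (linY r)).
have eq_pos g : pos g -> X r g = Y r g.
  by move=> g0; apply/eqP; rewrite eq_le XY// YX.
by rewrite !eq_pos//; exact: pospart_pos.
Qed.

Section PositivePart.
Variable X : R -> E -> R.
Hypothesis trX : trajectory X.

Definition tvals r f : set R :=
  [set y | exists t g, [/\ 0 < t, pos g, le g (S t f) & y = X (r + t) g]].

Definition tsup r f : R := sup (tvals r f).

Definition tpospart r : E -> R := cone_extend L (tsup r).

Let linX r : scalar (X r). Proof. by have [] := trX. Qed.

Let XS r t f : 0 < t -> X (r + t) (S t f) = X r f.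
Proof. by have [_ _] := trX; exact. Qed.

Lemma tvals0 r f : pos f -> tvals r f 0.
Proof.
move=> f0; exists 1, 0; rewrite (linear_for0 (linX _)); split=> //.
  exact: bl_pos0.
exact: posS.
Qed.

Lemma tvals_le c r f y : 0 <= c -> tbounded c X -> tvals r f y ->
  y <= c * M * `|f|.
Proof.
move=> c0 Xc [t [g [t0 g0 gf ->]]]; apply: le_trans (ler_norm _) _.
apply: le_trans (Xc _ _) _; rewrite -mulrA ler_wpM2l//.
exact: le_trans (bl_norm_le g0 gf) (SM t0 f).
Qed.

Lemma tsup_ge r f y : pos f -> tvals r f y -> y <= tsup r f.
Proof.
move=> f0 vy; apply: ub_le_sup => //; have [c c0 Xc] := trajectory_bounded trX.
by exists (c * M * `|f|) => z; exact: tvals_le.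
Qed.

Lemma tsup_le r f b : pos f -> ubound (tvals r f) b -> tsup r f <= b.
Proof. by move=> f0; apply: ge_sup; exists 0; exact: tvals0. Qed.

Lemma tvals_later r f y : tvals r f y -> exists2 s, 0 < s & forall t, s < t ->
  exists g, [/\ pos g, le g (S t f) & y = X (r + t) g].
Proof.
move=> [s [g [s0 g0 gf ->]]]; exists s => // t st.
have d0 : 0 < t - s by rewrite subr_gt0.
have -> : t = s + (t - s) by rewrite addrC subrK.
exists (S (t - s) g); rewrite (addrA r) XS// (mulS f s0 d0); split=> //.
  exact: posS.
exact: sg_mono.
Qed.

Lemma tsup_shift r t f : 0 < t -> pos f -> tsup (r + t) (S t f) = tsup r f.
Proof.
move=> t0 f0; have Sf0 : pos (S t f) by exact: posS.
apply/eqP; rewrite eq_le; apply/andP; split; apply: tsup_le => // y.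
  move=> [s [g [s0 g0 gf ->]]]; apply: tsup_ge => //.
  by exists (t + s), g; split; rewrite ?addr_gt0 ?addrA// mulS.
move=> /tvals_later[s s0 later]; apply: tsup_ge => //.
have [|g [g0 gf ->]] := later (t + s); first by rewrite ltrDr.
by exists s, g; split; rewrite ?addrA// -mulS.
Qed.

Lemma tsupD_le r f g : pos f -> pos g -> tsup r (f + g) <= tsup r f + tsup r g.
Proof.
move=> f0 g0; apply: tsup_le; first exact: bl_posD.
move=> _ [t [w [t0 w0 wfg ->]]]; rewrite (linear_forD (linS t0)) in wfg.
have [w1 [w2 [-> w10 w20 w1f w2g]]] :=
  riesz_decomposition (posS t0 f0) (posS t0 g0) w0 wfg.
by rewrite (linear_forD (linX _)) lerD//; apply: tsup_ge => //;
  [exists t, w1|exists t, w2].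
Qed.

Lemma tsupD r f g : pos f -> pos g -> tsup r (f + g) = tsup r f + tsup r g.
Proof.
move=> f0 g0; apply/eqP; rewrite eq_le tsupD_le//=.
rewrite -lerBrDr; apply: tsup_le => // y1 /tvals_later[s1 s10 later1].
rewrite lerBrDl -lerBrDr; apply: tsup_le => // y2 /tvals_later[s2 s20 later2].
have s0 : 0 < s1 + s2 by exact: addr_gt0.
rewrite lerBrDl; apply: tsup_ge; first exact: bl_posD.
have [|w1 [w10 w1f ->]] := later1 (s1 + s2); first by rewrite ltrDl.
have [|w2 [w20 w2g ->]] := later2 (s1 + s2); first by rewrite ltrDr.
exists (s1 + s2), (w1 + w2); rewrite (linear_forD (linX _)); split=> //.
  exact: bl_posD.
by rewrite (linear_forD (linS s0)); exact: bl_leD.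
Qed.

Lemma tsupZ_ge r a f : 0 < a -> pos f -> a * tsup r f <= tsup r (a *: f).
Proof.
move=> a0 f0; rewrite -ler_pdivlMl//; apply: tsup_le => // y [t [g [t0 g0 gf ->]]].
rewrite ler_pdivlMl//; apply: tsup_ge; first exact: bl_posZ (ltW a0) f0.
exists t, (a *: g); rewrite (scalar_forZ _ _ (linX _)); split=> //.
  exact: bl_posZ (ltW a0) g0.
by rewrite (linear_forZ _ _ (linS t0)); exact: bl_le_scale (ltW a0) gf.
Qed.

Lemma tsupZ r a f : 0 < a -> pos f -> tsup r (a *: f) = a * tsup r f.
Proof.
move=> a0 f0; apply/eqP; rewrite eq_le tsupZ_ge// andbT -ler_pdivrMl//.
have aV0 : 0 < a^-1 by rewrite invr_gt0.
apply: le_trans (tsupZ_ge r aV0 (bl_posZ (ltW a0) f0)) _.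
by rewrite scalerA mulVf ?gt_eqF// scale1r.
Qed.

Lemma tpospartE r f : pos f -> tpospart r f = tsup r f.
Proof. by apply: cone_extend_id => *; exact: tsupD. Qed.

Lemma tpospart_bounded c : 0 <= c -> tbounded c X -> tbounded (c * M) tpospart.
Proof.
move=> c0 Xc r f; apply: cone_extend_bounded => [|g g0].
  by rewrite mulr_ge0// ltW.
apply/andP; split; first exact: tsup_ge (tvals0 r g0).
by apply: tsup_le => // y; exact: tvals_le.
Qed.

Lemma trajectory_tpospart : trajectory tpospart.
Proof.
split=> [r||r t f t0].
- by apply: scalar_cone_extend => *; [exact: tsupD|exact: tsupZ].
- have [c c0 Xc] := trajectory_bounded trX.
  by exists (c * M); exact: tpospart_bounded.
- rewrite (pospart_decomp L f) (linear_forB (linS t0)).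
  rewrite /tpospart !(cone_extendB (tsupD _)) ?tsup_shift//; do ?apply: posS => //;
  exact: pospart_pos.
Qed.

Lemma tpospart_ge0 : tpos tpospart.
Proof. by move=> r f f0; rewrite tpospartE//; exact: tsup_ge (tvals0 r f0). Qed.

Lemma tpospart_ge : tle X tpospart.
Proof.
move=> r f f0; rewrite tpospartE//; apply: tsup_ge => //; exists 1, (S 1 f).
by rewrite XS//; split=> //; [exact: posS|exact: bl_le_refl].
Qed.

Lemma tpospart_least Y : trajectory Y -> tpos Y -> tle X Y -> tle tpospart Y.
Proof.
move=> [linY _ YS] Y0 XY r f f0; rewrite tpospartE//; apply: tsup_le => //.
move=> _ [t [g [t0 g0 /bl_subr_pos gf ->]]]; apply: le_trans (XY _ _ g0) _.
by rewrite -(YS r t f)// -subr_ge0 -(linear_forB (linY _)); exact: Y0.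
Qed.

End PositivePart.

Definition tdisjoint V Z : Prop :=
  forall W, trajectory W -> tpos W -> tle W V -> tle W Z -> W = 0.

Lemma tle_trans X Y Z : tle X Y -> tle Y Z -> tle X Z.
Proof. by move=> XY YZ r f f0; exact: le_trans (XY r f f0) (YZ r f f0). Qed.

Lemma tdisjointW V V' Z Z' : tle V' V -> tle Z' Z -> tdisjoint V Z ->
  tdisjoint V' Z'.
Proof.
move=> V'V Z'Z VZ W trW W0 WV WZ.
by apply: VZ => //; [exact: tle_trans V'V|exact: tle_trans Z'Z].
Qed.

Lemma trajectory_eq0 W : trajectory W -> tpos W -> tle W 0 -> W = 0.
Proof.
move=> trW W0 W0'; apply: trajectory_eq => //.
by rewrite -(scale0r W); exact: trajectoryZ.
Qed.

Lemma tpospart_disjoint X : trajectory X -> tdisjoint (tpospart X - X) (tpospart X).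
Proof.
move=> trX W trW W0 WN WP; apply: trajectory_eq0 => //.
have trP := trajectory_tpospart trX.
have : tle (tpospart X) (tpospart X - W).
  apply: tpospart_least => //; [exact: trajectoryB|exact/tpos_subr|].
  by move=> r f f0; have := WN r f f0; rewrite !fun2E; lra.
by move=> PW r f f0; have := PW r f f0; rewrite !fun2E; lra.
Qed.

Lemma tle_disjointD V X Y : trajectory V -> trajectory X -> trajectory Y ->
  tpos V -> tpos X -> tpos Y -> tdisjoint V Y -> tle V (X + Y) -> tle V X.
Proof.
move=> trV trX trY V0 X0 Y0 VY VXY; have trVX := trajectoryB trV trX.
have PV : tle (tpospart (V - X)) V.
  apply: tpospart_least => // r f f0.
  by have := X0 r f f0; rewrite !fun2E; lra.
have PY : tle (tpospart (V - X)) Y.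
  apply: tpospart_least => // r f f0.
  by have := VXY r f f0; rewrite !fun2E; lra.
have P0 := VY _ (trajectory_tpospart trVX) (tpospart_ge0 trVX) PV PY.
by move=> r f f0; have := tpospart_ge trVX r f0; rewrite P0 !fun2E; lra.
Qed.

(* [tpospart] multiplies bounds by [M], so the positive part of [tshift h X - X] is
   bounded by half of any bound of [X]. *)
Definition shift_near_id h : Prop :=
  forall X c, trajectory X -> 0 <= c -> tbounded c X ->
  tbounded (c / (2 * M)) (tshift h X - X).

Lemma shift_near_idN h : shift_near_id h -> shift_near_id (- h).
Proof.
move=> nearh X c trX c0 Xc r f; have := nearh X c trX c0 Xc (r - h) f.
by rewrite !fun2E /tshift subrK distrC.
Qed.

Lemma tbounded_half_eq0 W : trajectory W ->
  (forall c, 0 <= c -> tbounded c W -> tbounded (c / 2) W) -> W = 0.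
Proof.
move=> trW half; have [c c0 Wc] := trajectory_bounded trW.
have Wn n : tbounded (c / 2 ^+ n) W.
  elim: n => [|n IH]; first by rewrite expr0 divr1.
  by rewrite exprSr invfM mulrA; apply: half => //; rewrite divr_ge0// exprn_ge0.
apply/funext => r; apply/funext => f; apply/eqP.
rewrite -normr_eq0 eq_le normr_ge0 andbT.
apply: (@geometric_le0 _ 2^-1 (c * `|f|)); first by lra.
by move=> n; have := Wn n r f; rewrite exprVn mulrAC.
Qed.

Section DampedShift.
Variables (h lam : R).
Hypotheses (nearh : shift_near_id h) (lam0 : 0 < lam) (lam1 : lam < 1).

(* [W - tshift h W] has positive part [W], so [W] is bounded by half of any bound. *)
Lemma disjoint_tshift_eq0 W : trajectory W -> tpos W -> tdisjoint W (tshift h W) ->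
  W = 0.
Proof.
move=> trW W0 Wh; have trD := trajectoryB trW (trajectory_tshift h trW).
set D := W - tshift h W in trD; have trP := trajectory_tpospart trD.
have PW : tle (tpospart D) W.
  apply: tpospart_least => // r f f0.
  by have := W0 (r + h) f f0; rewrite /D !fun2E /tshift /=; lra.
have WP : W = tpospart D.
  apply/eqP; rewrite -subr_eq0; apply/eqP; apply: Wh; first exact: trajectoryB.
  - exact/tpos_subr.
  - by move=> r f f0; have := tpospart_ge0 trD r f0; rewrite !fun2E; lra.
  - by move=> r f f0; have := tpospart_ge trD r f0; rewrite /D !fun2E; lra.
apply: tbounded_half_eq0 => // c c0 Wc.
have c2M : 0 <= c / (2 * M) by rewrite divr_ge0// mulr_ge0// ltW.
have -> : c / 2 = c / (2 * M) * M by rewrite invfM mulrA mulfVK ?gt_eqF.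
rewrite WP; apply: tpospart_bounded => // r f.
by rewrite /D !fun2E distrC; exact: nearh.
Qed.

Definition damped_shift X : R -> E -> R := lam *: tshift (- h) X.

Local Notation T := damped_shift.

Lemma trajectory_iter_damped n X : trajectory X -> trajectory (iter n T X).
Proof. by move=> trX; elim: n => //= n IH; exact/trajectoryZ/trajectory_tshift. Qed.

Lemma tpos_iter_damped n X : tpos X -> tpos (iter n T X).
Proof.
move=> X0; elim: n => //= n IH r f f0.
by rewrite /T fun2E mulr_ge0 ?(ltW lam0)//; exact: IH.
Qed.

Lemma iter_dampedD n X Y : iter n T (X + Y) = iter n T X + iter n T Y.
Proof. by elim: n => //= n ->; rewrite /T -scalerDr. Qed.

Lemma iter_damped_mono n X Y : tle X Y -> tle (iter n T X) (iter n T Y).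
Proof.
move=> XY; elim: n => //= n IH r f f0.
by rewrite /T !fun2E ler_wpM2l ?(ltW lam0)// IH.
Qed.

Lemma iter_damped_bounded n c X : tbounded c X ->
  tbounded (c * lam ^+ n) (iter n T X).
Proof.
move=> Xc; elim: n => [|n IH] r f; first by rewrite mulr1.
rewrite /= /T fun2E normrM gtr0_norm// exprS mulrCA -mulrA ler_wpM2l ?(ltW lam0)//.
exact: IH.
Qed.

Lemma tdisjoint_damped V Z : trajectory Z -> tpos Z -> tdisjoint V Z ->
  tdisjoint V (T Z).
Proof.
move=> trZ Z0 VZ W trW W0 WV WZ; apply: disjoint_tshift_eq0 => //.
apply: tdisjointW VZ => // r f f0; apply: le_trans (WZ _ _ f0) _.
by rewrite /T fun2E /tshift addrK ler_piMl ?Z0// ltW.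
Qed.

Lemma negpart_defect_le_iter_damped X n : trajectory X -> tpos X ->
  tle (tpospart (X - T X) - (X - T X)) (iter n.+1 T X).
Proof.
move=> trX X0; have trT k Y : trajectory Y -> trajectory (iter k T Y).
  exact: trajectory_iter_damped.
have trD : trajectory (X - T X) by apply: trajectoryB => //; exact: (trT 1%N).
set Z := tpospart (X - T X); have trZ : trajectory Z by exact: trajectory_tpospart.
have Z0 : tpos Z by exact: tpospart_ge0.
pose V := Z - (X - T X); have trV : trajectory V by exact: trajectoryB.
have V0 : tpos V by apply/tpos_subr; exact: tpospart_ge.
have VZ k : tdisjoint V (iter k T Z).
  elim: k => [|k IH]; first exact: tpospart_disjoint.
  by apply: tdisjoint_damped => //; [exact: trT|exact: tpos_iter_damped].
have XTZ : tle X (T X + Z).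
  by move=> r f f0; have := tpospart_ge trD r f0; rewrite -/Z !fun2E; lra.
elim: n => [|n IH].
  have ZX : tle Z X.
    apply: tpospart_least => // r f f0.
    by have := @tpos_iter_damped 1 _ X0 r f f0; rewrite !fun2E; lra.
  by move=> r f f0; have := ZX r f f0; rewrite !fun2E; lra.
apply: (tle_disjointD trV (trT n.+2 _ trX) (trT n.+1 _ trZ) V0 _ _ (VZ n.+1)).
- exact: tpos_iter_damped.
- exact: tpos_iter_damped.
- apply: tle_trans IH _; rewrite [iter n.+2 _ _]iterSr -iter_dampedD.
  exact: iter_damped_mono.
Qed.

Lemma damped_shift_le X : trajectory X -> tpos X -> tle (T X) X.
Proof.
move=> trX X0; have [c c0 Xc] := trajectory_bounded trX.
have trD : trajectory (X - T X).
  by apply: trajectoryB => //; exact: (@trajectory_iter_damped 1).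
have neg0 : tle (tpospart (X - T X) - (X - T X)) 0.
  move=> r f f0; apply: (@geometric_le0 _ lam (c * lam * `|f|)); first by rewrite ltW.
  move=> n; apply: le_trans (negpart_defect_le_iter_damped n trX X0 r f0) _.
  apply: le_trans (ler_norm _) _.
  by have := @iter_damped_bounded n.+1 c X Xc r f; rewrite exprS mulrA mulrAC.
move=> r f f0; have := neg0 r f f0; have := tpospart_ge0 trD r f0.
by rewrite !fun2E; lra.
Qed.

End DampedShift.

Lemma tshift_opp_le h X : shift_near_id h -> trajectory X -> tpos X ->
  tle (tshift (- h) X) X.
Proof.
move=> nearh trX X0 r f f0; set y := tshift (- h) X r f.
have lamy : lam * y @[lam --> 1^'-] --> y.
  rewrite -[X in _ --> X]mul1r; apply: cvgMr_tmp; exact: cvg_at_left_filter.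
apply: (cvgr_to_le lamy); near=> lam.
have lam0 : 0 < lam by near: lam; exact: nbhs_left_gt.
have lam1 : lam < 1 by near: lam; exact: nbhs_left_lt.
exact: (damped_shift_le nearh lam0 lam1).
Unshelve. all: by end_near. Qed.

Lemma tshift_pos_id h X : shift_near_id h -> trajectory X -> tpos X ->
  tshift h X = X.
Proof.
move=> nearh trX X0; apply: trajectory_eq => //; first exact: trajectory_tshift.
  by have := tshift_opp_le (shift_near_idN nearh) trX X0; rewrite opprK.
move=> r f f0; have := tshift_opp_le nearh trX X0 (r + h) f0.
by rewrite /tshift addrK.
Qed.

Lemma tshift_id h X : shift_near_id h -> trajectory X -> tshift h X = X.
Proof.
move=> nearh trX; have trP := trajectory_tpospart trX.
have Pid := tshift_pos_id nearh trP (tpospart_ge0 trX).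
have trN := trajectoryB trP trX.
have Nid := tshift_pos_id nearh trN ((tpos_subr _ _).2 (tpospart_ge trX)).
apply/funext => r; apply/funext => f.
have := congr1 (fun Y => Y r f) Nid; have := congr1 (fun Y => Y r f) Pid.
by rewrite /tshift !fun2E; lra.
Qed.

Lemma norm_continuous_shift_near_id : eventually_norm_continuous S ->
  exists2 d, 0 < d & forall h, 0 < h < d -> shift_near_id h.
Proof.
move=> [t0 [t00 contS]]; have t1 : t0 < t0 + 1 by rewrite ltrDl.
have M20 : 0 < (2 * M)^-1 by rewrite invr_gt0 mulr_gt0.
have [d [d0 dS]] := contS _ t1 _ M20.
exists d => // h /andP[h0 hd] X c [linX _ XS] c0 Xc r f.
have s0 : 0 < t0 + 1 by exact: le_lt_trans t1.
have sh0 : 0 < t0 + 1 + h by exact: addr_gt0.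
rewrite fun2E /tshift -(XS r _ f sh0) -(XS (r + h) _ f s0).
rewrite -addrA [h + _]addrC -(linear_forB (linX _)); apply: le_trans (Xc _ _) _.
rewrite -mulrA ler_wpM2l// distrC; apply: dS; first by lra.
by rewrite addrAC subrr add0r gtr0_norm.
Qed.

Lemma trajectory_const X : eventually_norm_continuous S -> trajectory X ->
  forall r t, 0 < t -> X (r + t) = X r.
Proof.
move=> /norm_continuous_shift_near_id[d d0 near_id] trX r t t0.
have [N _ /(_ N (leqnn N))[N0]] := near_divr_nat_lt t d0.
set h := t / N%:R => hd.
have h0 : 0 < h by rewrite divr_gt0// ltr0n.
have Xh s : X (s + h) = X s.
  have nearh : shift_near_id h by apply: near_id; rewrite h0.
  by have := tshift_id nearh trX => /(congr1 (fun Y => Y s)).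
have XN n : X (r + n%:R * h) = X r.
  elim: n => [|n IH]; first by rewrite mul0r addr0.
  by rewrite -natr1 mulrDl mul1r addrA Xh.
by rewrite -(XN N) mulrC mulfVK// pnatr_eq0 -lt0n.
Qed.

Lemma trajectory_invariant X : eventually_norm_continuous S -> trajectory X ->
  forall r t f, 0 < t -> X r (S t f) = X r f.
Proof.
move=> enc trX r t f t0; have [_ _ /(_ r t f t0)] := trX.
by rewrite (trajectory_const enc trX).
Qed.

End Trajectories.

(** * The kernels of the generator and of its dual *)

Definition fixed_point (R : realType) (E : normedModType R) (S : R -> E -> E)
  (f : E) : Prop :=
  forall t, 0 < t -> S t f = f.

Definition invariant_functional (R : realType) (E : normedModType R)
  (S : R -> E -> E) (phi : E -> R) : Prop :=
  is_dual phi /\ forall t f, 0 < t -> phi (S t f) = phi f.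

Lemma sg_bounded_ge1 (R : realType) (E : normedModType R) (S : R -> E -> E) :
  sg_bounded S -> exists2 M, 1 <= M & sg_bound S M.
Proof.
move=> [M SM]; exists (Num.max M 1); first by rewrite le_max lexx orbT.
move=> t t0 f; apply: le_trans (SM t t0 f) _.
by rewrite ler_wpM2r// le_max lexx.
Qed.

Lemma C0_operator_semigroup (R : realType) (E : normedModType R) (S : R -> E -> E) :
  C0_semigroup S -> operator_semigroup S.
Proof. by move=> [contS [mulS _]]; split=> // t /contS[]. Qed.

Section Generator.
Context {R : realType} {E : completeNormedModType R}.
Variable S : R -> E -> E.
Hypotheses (C0 : C0_semigroup S) (bndS : sg_bounded S).
Implicit Types (s t h e : R) (f g w : E) (phi : E -> R).

Let linS t : 0 < t -> linear (S t).
Proof. exact: (C0_operator_semigroup C0).1. Qed.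

Let contS t : 0 < t -> continuous (S t).
Proof. by case: C0 => + _ => /[apply] -[]. Qed.

Let mulS s t f : 0 < s -> 0 < t -> S (s + t) f = S t (S s f).
Proof. by move=> s0 t0; exact: (C0_operator_semigroup C0).2. Qed.

(* The values [S t f] for [t <= 0] are junk. *)
Definition orbit f t : E := if 0 < t then S t f else f.

Lemma orbit_gt0 f t : 0 < t -> orbit f t = S t f.
Proof. by rewrite /orbit => ->. Qed.

Lemma orbit_le0 f t : t <= 0 -> orbit f t = f.
Proof. by rewrite /orbit ltNge => ->. Qed.

Lemma sg_orbit f s t : 0 < s -> 0 <= t -> S s (orbit f t) = orbit f (t + s).
Proof.
move=> s0; rewrite le_eqVlt => /predU1P[<-|t0].
  by rewrite add0r orbit_le0// orbit_gt0.
by rewrite !orbit_gt0 ?addr_gt0// mulS.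
Qed.

Lemma unif_continuous_orbit f : unif_continuous (orbit f).
Proof.
apply/unif_continuous_normP => e e0; have [M M1 SM] := sg_bounded_ge1 bndS.
have M0 : 0 < M by exact: lt_le_trans M1.
have [_ [_ [_ /(_ f)/cvgrPdist_lt/(_ (e / M) (divr_gt0 e0 M0))]]] := C0.
move=> /nbhs_ballP[d /= d0 nearf].
have near0 t : t < d -> `|orbit f t - f| < e / M.
  move=> td; have [t0|t0] := ltP 0 t; last first.
    by rewrite orbit_le0// subrr normr0 divr_gt0.
  rewrite orbit_gt0// distrC; apply: nearf => //.
  by rewrite /ball/= sub0r normrN gtr0_norm.
exists d => // x y; wlog xy : x y / x <= y => [hwlog|].
  have [/hwlog//|/ltW/hwlog h xyd] := leP x y.
  by rewrite distrC; apply: h; rewrite distrC.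
rewrite distrC ger0_norm ?subr_ge0// distrC => yxd.
have [x0|x0] := ltP 0 x; last first.
  rewrite (orbit_le0 _ x0).
  have [y0|y0] := ltP 0 y; last by rewrite orbit_le0// subrr normr0.
  apply: lt_le_trans (near0 y _) _; first by lra.
  by rewrite ler_pdivrMr// ler_peMr// ltW.
have -> : orbit f y = S x (orbit f (y - x)).
  by rewrite sg_orbit ?subr_ge0// subrK.
rewrite [orbit f x]orbit_gt0// -(linear_forB (linS x0)).
apply: le_lt_trans (SM _ x0 _) _; rewrite mulrC -ltr_pdivlMr//.
exact: near0.
Qed.
Lemma orbit_integral f a b : a <= b -> exists w, weak_integral (orbit f) a b w.
Proof.
move=> ab; exact: unif_continuous_weak_integral ab (unif_continuous_orbit f).
Qed.

Lemma sg_orbit_integral f t h w v z : 0 < t -> 0 < h ->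
  weak_integral (orbit f) 0 t w -> weak_integral (orbit f) 0 h z ->
  weak_integral (orbit f) t (t + h) v -> S h w - w = v - z.
Proof.
move=> t0 h0 Iw Iz Iv.
have cf := unif_continuous_continuous (unif_continuous_orbit f).
have Shw : weak_integral (orbit f) (0 + h) (t + h) (S h w).
  apply: (weak_integral_map (linS h0) (contS h0)) Iw => x /andP[x0 _].
  exact: sg_orbit.
rewrite add0r in Shw.
have zSw : z + S h w = w + v.
  apply: (@weak_integral_unique _ _ (orbit f) 0 (t + h)) => //.
    by apply: weak_integral_cat Iz Shw; rewrite ltW//= lerDr ltW.
  by apply: weak_integral_cat Iw Iv; rewrite ltW//= lerDl ltW.
by apply/eqP; rewrite subr_eq addrAC [v + w]addrC -zSw addrC addKr.
Qed.

Lemma generator_orbit_integral f t w : 0 < t -> weak_integral (orbit f) 0 t w ->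
  generator S w (S t f - f).
Proof.
move=> t0 Iw; apply/cvgrPdist_le => e e0.
have ucf := unif_continuous_orbit f; have cf := unif_continuous_continuous ucf.
have [d d0 fd] := (unif_continuous_normP _).1 ucf (e / 2) (divr_gt0 e0 (ltr0n R 2)).
near=> h; have h0 : 0 < h by near: h; exact: nbhs_right_gt.
have hd : h < d by near: h; exact: nbhs_right_lt.
have [|v Iv] := @orbit_integral f t (t + h); first by rewrite lerDl ltW.
have [|z Iz] := @orbit_integral f 0 (0 + h); first by rewrite add0r ltW.
have close a x : a <= x <= a + h -> `|orbit f x - orbit f a| <= e / 2.
  move=> /andP[ax xah]; apply/ltW/fd; rewrite ger0_norm ?subr_ge0//.
  by apply: le_lt_trans hd; rewrite lerBlDl.
have vt := weak_integral_approx cf (ltW h0) (close t) Iv.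
have z0 := weak_integral_approx cf (ltW h0) (close 0) Iz.
rewrite add0r in Iz; rewrite (sg_orbit_integral t0 h0 Iw Iz Iv).
rewrite -(orbit_gt0 f t0) -{2}(@orbit_le0 f 0)//.
have -> : orbit f t - orbit f 0 - h^-1 *: (v - z) =
    h^-1 *: ((z - h *: orbit f 0) - (v - h *: orbit f t)).
  rewrite !scalerBr !scalerA mulVf ?gt_eqF// !scale1r !opprB.
  by rewrite addrACA [RHS]addrACA; congr (_ + _); rewrite addrC.
rewrite normrZ gtr0_norm ?invr_gt0// ler_pdivrMl//.
by apply: le_trans (ler_normB _ _) _; lra.
Unshelve. all: by end_near. Qed.

Lemma ker_dual_genE : ker_dual_gen S = invariant_functional S.
Proof.
rewrite predeqE => phi; split=> [[dphi phi0]|[dphi inv]]; split=> //.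
  move=> t f t0; have [w Iw] := orbit_integral f (ltW t0).
  have := phi0 _ _ (generator_orbit_integral t0 Iw).
  by rewrite (linear_forB dphi.1) => /eqP; rewrite subr_eq0 => /eqP.
move=> f g Afg; apply: (@cvg_unique _ (@norm_hausdorff _ R^o)
  (phi (h^-1 *: (S h f - f)) @[h --> 0^'+])).
  exact: continuous_cvg (dphi.2 g) Afg.
apply: cvg_near_cst; near=> h.
have h0 : 0 < h by near: h; exact: nbhs_right_gt.
by rewrite (scalar_forZ _ _ dphi.1) (linear_forB dphi.1) inv// subrr mulr0.
Unshelve. all: by end_near. Qed.

Lemma norm_sg_increment M f s n : 1 <= M -> sg_bound S M -> 0 < s ->
  `|S (n.+1%:R * s) f - f| <= n.+1%:R * (M * `|S s f - f|).
Proof.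
move=> M1 SM s0; elim: n => [|n IH]; first by rewrite !mul1r ler_peMl.
have ns0 : 0 < n.+1%:R * s by rewrite mulr_gt0// ltr0n.
rewrite -(natr1 n.+1) !mulrDl !mul1r [_ + s]addrC mulS//.
have -> : S (n.+1%:R * s) (S s f) - f =
    S (n.+1%:R * s) f - f + S (n.+1%:R * s) (S s f - f).
  by rewrite (linear_forB (linS ns0)) [RHS]addrC addrA subrK.
exact: le_trans (ler_normD _ _) (lerD IH (SM _ ns0 _)).
Qed.

Lemma ker_genE : ker_gen S = fixed_point S.
Proof.
rewrite predeqE => f; split=> [Af t t0|fixf]; last first.
  apply: cvg_near_cst; near=> h.
  by rewrite fixf ?subrr ?scaler0//; near: h; exact: nbhs_right_gt.
have [M M1 SM] := sg_bounded_ge1 bndS; pose h n : R := t * n.+1%:R^-1.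
have h0 n : 0 < h n by rewrite divr_gt0.
have nh n : n.+1%:R * h n = t by rewrite mulrC mulfVK// pnatr_eq0.
have hcvg : h n @[n --> \oo] --> 0.
  by rewrite -[X in _ --> X](mulr0 t); apply: cvgMl_tmp; exact: cvg_harmonic.
have Ah : `|(h n)^-1 *: (S (h n) f - f)| @[n --> \oo] --> (0 : R).
  by rewrite -(normr0 E); apply: ((cvg_at_rightP _ _ _).1 (cvg_norm Af)).
have : t * (M * `|(h n)^-1 *: (S (h n) f - f)|) @[n --> \oo] --> t * (M * 0).
  by do 2 apply: cvgMl_tmp.
rewrite !mulr0 => tAh.
apply/eqP; rewrite -subr_eq0 -normr_eq0 eq_le normr_ge0 andbT.
apply: (cvgr_to_ge tAh); apply: nearW => n.
have := norm_sg_increment f n M1 SM (h0 n); rewrite nh => /le_trans; apply.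
rewrite normrZ gtr0_norm ?invr_gt0// -{1}(nh n).
by rewrite le_eqVlt; apply/orP; left; apply/eqP; field; rewrite gt_eqF.
Unshelve. all: by end_near. Qed.

Lemma sg_limit_fixed f g : S^~ f @ +oo --> g -> fixed_point S g.
Proof.
move=> fg t t0.
apply: (@cvg_unique _ (@norm_hausdorff _ E) (S t (S s f) @[s --> +oo])).
  exact: continuous_cvg (contS t0 (x := g)) fg.
apply: cvg_trans (cvg_comp _ _ (cvg_addrr t) fg); apply: near_eq_cvg; near=> s.
by rewrite /= mulS//; near: s; exact: nbhs_pinfty_gt.
Unshelve. all: by end_near. Qed.

Lemma invariant_limit phi f g : invariant_functional S phi ->
  S^~ f @ +oo --> g -> phi f = phi g.
Proof.
move=> [dphi inv] fg; apply: (@cvg_unique _ (@norm_hausdorff _ R^o)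
  (phi (S s f) @[s --> +oo])); last exact: continuous_cvg (dphi.2 g) fg.
apply: cvg_near_cst; near=> s.
by rewrite inv//; near: s; exact: nbhs_pinfty_gt.
Unshelve. all: by end_near. Qed.

End Generator.
(** * Invariant functionals and convergence *)

Lemma ultra_bounded_cvg (R : realType) (T : Type) (U : set_system T) (u : T -> R)
  (c : R) : UltraFilter U -> U [set t | `|u t| <= c] -> cvg (u @ U).
Proof.
move=> UU uc; have Uc : (u @ U) `[- c, c]%classic.
  by apply: (@filterS _ U) uc => t /=; rewrite in_itv/= -ler_norml.
have [l [_ cl]] := @segment_compact R (- c) c (u @ U) _ Uc.
apply/cvg_ex; exists l => B lB; have [//|UNB] := in_ultra_setVsetC (u @^-1` B) UU.
by have [z [/= NBz Bz]] := cl (~` B) B UNB lB.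
Qed.

Section LimitTrajectory.
Context {R : realType} {E : normedModType R}.
Variables (S : R -> E -> E) (U : set_system R) (psi : R -> E -> R).
Hypotheses (semigS : operator_semigroup S) (bndS : sg_bounded S)
  (UU : UltraFilter U) (Uoo : forall r, U [set t | r < t])
  (linpsi : forall t, scalar (psi t)) (psi1 : forall t f, `|psi t f| <= `|f|).

Local Notation pullback r f := (fun t => psi t (S (t - r) f)).

Definition limit_trajectory (r : R) (f : E) : R := lim (pullback r f @ U).

Lemma pullback_bounded :
  exists c, forall r f, U [set t | `|pullback r f t| <= c * `|f|].
Proof.
have [M SM] := bndS; exists M => r f; apply: filterS (Uoo r) => t /= rt.
by apply: le_trans (psi1 _ _) _; apply: SM; rewrite subr_gt0.
Qed.

Lemma limit_trajectory_cvg r f : pullback r f @ U --> limit_trajectory r f.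
Proof. by have [c uc] := pullback_bounded; exact: ultra_bounded_cvg (uc r f). Qed.

Lemma limit_trajectory_unique r f (v : R -> R) (l : R) :
  U [set t | pullback r f t = v t] -> v @ U --> l -> limit_trajectory r f = l.
Proof.
move=> uv vl; apply: (@cvg_unique _ (@norm_hausdorff _ R^o) (v @ U)) => //.
apply: cvg_trans (@limit_trajectory_cvg r f); apply: near_eq_cvg.
by apply: filterS uv => t /= ->.
Qed.

Lemma trajectory_limit : trajectory S limit_trajectory.
Proof.
have [c uc] := pullback_bounded; split.
- move=> r a x y.
  apply: (limit_trajectory_unique
    (v := fun t => a * pullback r x t + pullback r y t)).
    by apply: filterS (Uoo r) => t /= rt; rewrite semigS.1 ?subr_gt0// linpsi.
  by apply: cvgD; [apply: cvgMl_tmp|]; exact: limit_trajectory_cvg.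
- exists c => r f; apply: (cvgr_to_le (cvg_norm (@limit_trajectory_cvg r f))).
  exact: uc.
- move=> r t f t0; apply: limit_trajectory_unique (@limit_trajectory_cvg r f).
  apply: filterS (Uoo (r + t)) => s /= rts.
  have s0 : 0 < s - (r + t) by rewrite subr_gt0.
  by rewrite -semigS.2//; congr (psi s (S _ f)); ring.
Qed.

End LimitTrajectory.

Section Invariant.
Context {R : realType} {E : normedModType R} (L : banach_lattice E).
Variable S : R -> E -> E.
Hypotheses (semigS : operator_semigroup S) (bndS : sg_bounded S)
  (posS : sg_positive L S) (enc : eventually_norm_continuous S).

Lemma invariant_functional_of_trajectory X r : trajectory S X ->
  invariant_functional S (X r).
Proof.
move=> trX; have [M M1 SM] := sg_bounded_ge1 bndS; have [linX [c Xc] _] := trX.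
split; first exact: bounded_is_dual (linX r) (Xc r).
by move=> t f; exact: (trajectory_invariant semigS posS (lt_le_trans ltr01 M1) SM).
Qed.

Lemma trajectory_of_invariant_functional phi : invariant_functional S phi ->
  trajectory S (fun=> phi).
Proof.
move=> [dphi inv]; have [c _ phic] := is_dual_lipschitz dphi.
by split=> [_||_]; [exact: dphi.1|exists c|exact: inv].
Qed.

Lemma annihilated_cvg0 f : (forall phi, invariant_functional S phi -> phi f = 0) ->
  S^~ f @ +oo --> 0.
Proof.
move=> ann; apply/cvgr0Pnorm_le => e e0; apply: contrapT => Nle.
pose D := [set t | e < `|S t f|].
have FD : ProperFilter (within D (pinfty_nbhs R)).
  split; last exact: within_filter.
  move=> [A [Areal AD]]; apply: Nle; exists A; split=> // t At.
  by rewrite leNgt; apply/negP => /(AD t At).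
have [U [UU DU]] := ultraFilterLemma FD.
have Uoo r : U [set t | r < t].
  by apply: DU; exists r; split=> [|t rt _] //; exact: num_real.
have UD : U D by apply: DU; exists 0; split=> [|t _] //; exact: num_real.
have /choice[psi psiP] := fun t => norming_functional (S t f).
have linpsi t : scalar (psi t) by have [[]] := psiP t.
have psi1 t g : `|psi t g| <= `|g| by have [_ + _] := psiP t; exact.
have trX := trajectory_limit semigS bndS UU Uoo linpsi psi1.
have := ann _ (invariant_functional_of_trajectory 0 trX).
suff : e <= limit_trajectory S U psi 0 f by lra.
have cvgX : psi t (S (t - 0) f) @[t --> U] --> limit_trajectory S U psi 0 f.
  exact: limit_trajectory_cvg.
apply: (cvgr_to_ge cvgX); apply: filterS UD => t /= et.
by rewrite subr0; have [_ _ ->] := psiP t; exact: ltW.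
Qed.

Lemma invariant_functional_pos phi f : invariant_functional S phi -> phi f <> 0 ->
  exists chi, invariant_functional S chi /\ dual_strict_pos L chi.
Proof.
move=> /trajectory_of_invariant_functional trX phif; set X := fun=> phi in trX.
have [M M1 SM] := sg_bounded_ge1 bndS; have M0 : 0 < M by exact: lt_le_trans M1.
have trP := trajectory_tpospart semigS posS M0 SM trX.
have P0 := tpospart_ge0 semigS posS SM trX.
have XP := tpospart_ge semigS posS SM trX.
have [Pf|Pf] := pselect (tpospart L S X 0 f = 0).
  exists ((tpospart L S X - X) 0); split.
    by apply: invariant_functional_of_trajectory; exact: trajectoryB.
  split; first exact: (tpos_subr _ _ _).2 XP 0.
  by exists f; rewrite subr_fun2E Pf /X; lra.
exists (tpospart L S X 0); split; first exact: invariant_functional_of_trajectory.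
by split; [exact: P0|exists f].
Qed.

End Invariant.

(** * Irreducible semigroups *)

Section Irreducible.
Context {R : realType} {E : normedModType R} (L : banach_lattice E).
Variables (S : R -> E -> E) (phi : E -> R).
Hypotheses (semigS : operator_semigroup S) (posS : sg_positive L S)
  (irrS : sg_irreducible L S) (invphi : invariant_functional S phi)
  (phi0 : dual_strict_pos L phi).
Implicit Types u x : E.
Local Notation pos := (bl_pos L).
Local Notation le := (bl_le L).

Lemma invariant_strictly_positive : strictly_positive L phi.
Proof.
have [dphi inv] := invphi; split=> // f f0; have [t [t0]] := irrS f0 dphi phi0.
by rewrite inv.
Qed.

Lemma invariant_pos_eq0 x : pos x -> phi x = 0 -> x = 0.
Proof.
move=> x0 phix; apply: contrapT => xn0.
by have := invariant_strictly_positive.2 _ (conj x0 xn0); rewrite phix ltxx.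
Qed.

Lemma fixed_pointB x y : fixed_point S x -> fixed_point S y -> fixed_point S (x - y).
Proof. by move=> fx fy t t0; rewrite (linear_forB (semigS.1 t t0)) fx ?fy. Qed.

Lemma fixed_pointZ a x : fixed_point S x -> fixed_point S (a *: x).
Proof. by move=> fx t t0; rewrite (linear_forZ _ _ (semigS.1 t t0)) fx. Qed.

Lemma fixed_pointN x : fixed_point S x -> fixed_point S (- x).
Proof. by move=> /(fixed_pointZ (-1)); rewrite scaleN1r. Qed.

Lemma fixed_quasi_interior u : fixed_point S u -> pos u -> u <> 0 ->
  quasi_interior L u.
Proof.
move=> fu u0 un0; apply: quasi_interior_of_dual => // chi dchi chi0.
have [t [t0]] := irrS (conj u0 un0) dchi chi0.
by rewrite fu.
Qed.

(* [S t x^+ - x^+] is positive and annihilated by [phi]. *)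
Lemma fixed_pospart x : fixed_point S x -> fixed_point S (pospart L x).
Proof.
move=> fx t t0; have [dphi inv] := invphi.
apply/eqP; rewrite -subr_eq0; apply/eqP/invariant_pos_eq0; last first.
  by rewrite (linear_forB dphi.1) inv// subrr.
apply/bl_subr_pos/pospart_least; first by apply: posS => //; exact: pospart_pos.
by rewrite -{1}(fx t t0); apply: (sg_mono semigS posS t0); exact: pospart_ge.
Qed.

Lemma fixed_total x : fixed_point S x -> pos x \/ pos (- x).
Proof.
move=> fx; have [xp|xp] := pselect (pospart L x = 0).
  by right; have /bl_subr_pos := pospart_ge L x; rewrite xp sub0r.
left; have qi := fixed_quasi_interior (fixed_pospart fx) (pospart_pos L x) xp.
have Nx : pospart L (- x) = 0.
  apply: quasi_interior_disjoint_eq0 qi (pospart_pos L _) _ => w w0 wN wp.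
  exact: pospart_disjoint wp wN.
by rewrite (pospart_decomp L x) Nx subr0; exact: pospart_pos.
Qed.

Lemma fixed_point_normalized x : fixed_point S x -> x <> 0 ->
  exists u, [/\ fixed_point S u, pos u & phi u = 1].
Proof.
have [[lin _] _] := invphi.
have normalize y : fixed_point S y -> pos y -> y <> 0 ->
    exists u, [/\ fixed_point S u, pos u & phi u = 1].
  move=> fy y0 yn0; have phiy : 0 < phi y by exact: invariant_strictly_positive.2.
  exists ((phi y)^-1 *: y); split; first exact: fixed_pointZ.
  - by apply: bl_posZ y0; rewrite invr_ge0 ltW.
  - by rewrite (scalar_forZ _ _ lin) mulVf// gt_eqF.
move=> fx x0; have [xp|xN] := fixed_total fx; first exact: normalize xp x0.
apply: normalize xN _; first exact: fixed_pointN.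
by move=> /eqP; rewrite oppr_eq0 => /eqP.
Qed.

Lemma fixed_span u x : fixed_point S u -> phi u = 1 -> fixed_point S x ->
  x = phi x *: u.
Proof.
move=> fu phiu fx; have [[lin _] _] := invphi.
have fxu : fixed_point S (x - phi x *: u).
  by apply: fixed_pointB fx _; exact: fixed_pointZ.
have phixu : phi (x - phi x *: u) = 0.
  by rewrite (linear_forB lin) (scalar_forZ _ _ lin) phiu mulr1 subrr.
apply/eqP; rewrite -subr_eq0; apply/eqP; have [xup|xuN] := fixed_total fxu.
  exact: invariant_pos_eq0.
apply: oppr_inj; rewrite oppr0; apply: invariant_pos_eq0 => //.
by rewrite (linear_forN lin) phixu oppr0.
Qed.

End Irreducible.

Lemma ddim1_or_ge2 (R : realType) (E : normedModType R) (K : (E -> R) -> Prop)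
  (phi : E -> R) (f : E) : K phi -> phi f <> 0 -> ddim1 K \/ ddim_ge2 K.
Proof.
move=> Kphi phif; have [multiples|] :=
  pselect (forall chi, K chi -> exists c : R, forall g, chi g = c * phi g).
  by left; exists phi; split=> //; split=> //; exists f.
move=> /existsNP[chi /not_implyP[Kchi Nmult]].
right; exists phi, chi; split=> //; split=> // a b ab.
have b0 : b = 0.
  apply: contrapT => /eqP b0; apply: Nmult; exists (- a / b) => g.
  by apply: (mulfI b0); rewrite mulrA mulrCA divff// mulr1; have := ab g; lra.
split=> //; have := ab f; rewrite b0 mul0r addr0 => /eqP.
by rewrite mulf_eq0 => /orP[/eqP//|/eqP].
Qed.

Section Convergence.
Context {R : realType} {E : completeNormedModType R} (L : banach_lattice E).
Variables (S : R -> E -> E) (phi : E -> R).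
Hypotheses (C0 : C0_semigroup S) (bndS : sg_bounded S) (posS : sg_positive L S)
  (irrS : sg_irreducible L S) (enc : eventually_norm_continuous S)
  (invphi : invariant_functional S phi) (phi0 : dual_strict_pos L phi).

Let semigS : operator_semigroup S. Proof. exact: C0_operator_semigroup. Qed.

Lemma strongly_convergent_fixed_point : strongly_convergent S ->
  exists u, [/\ fixed_point S u, bl_pos L u & phi u = 1].
Proof.
move=> cvgS; have [_ [f phif]] := phi0; have [g fg] := cvgS f.
have fixg := sg_limit_fixed C0 fg.
apply: (fixed_point_normalized semigS posS irrS invphi phi0 fixg) => g0.
by apply: phif; rewrite (invariant_limit invphi fg) g0 (linear_for0 invphi.1.1).
Qed.

Lemma strongly_convergent_ddim1 : strongly_convergent S ->
  ddim1 (invariant_functional S).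
Proof.
move=> cvgS; have [u [fu u0 phiu]] := strongly_convergent_fixed_point cvgS.
have [_ phif] := phi0; exists phi; split=> //; split=> // chi invchi.
exists (chi u) => f; have [g fg] := cvgS f.
rewrite (invariant_limit invchi fg) (invariant_limit invphi fg) mulrC.
rewrite -(scalar_forZ _ _ invchi.1.1); congr chi.
exact: (fixed_span semigS posS irrS invphi phi0 fu phiu (sg_limit_fixed C0 fg)).
Qed.

Lemma ddim1_cvg_projection u f : ddim1 (invariant_functional S) ->
  fixed_point S u -> phi u = 1 -> S^~ f @ +oo --> phi f *: u.
Proof.
move=> [psi [invpsi [_ span]]] fu phiu; have [[lin _] _] := invphi.
have ann chi : invariant_functional S chi -> chi (f - phi f *: u) = 0.
  have phip : phi (f - phi f *: u) = 0.
    by rewrite (linear_forB lin) (scalar_forZ _ _ lin) phiu mulr1 subrr.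
  have [a phia] := span _ invphi; move=> /span[b ->].
  have a0 : a != 0.
    by apply: contra_eq_neq phiu => a0; rewrite phia a0 mul0r eq_sym oner_neq0.
  by move/eqP: phip; rewrite phia mulf_eq0 (negbTE a0) => /eqP ->; rewrite mulr0.
have fixp : fixed_point S (phi f *: u) by exact: fixed_pointZ.
apply/subr_cvg0; apply: cvg_trans (annihilated_cvg0 semigS bndS posS enc ann).
apply: near_eq_cvg; near=> t; have t0 : 0 < t by near: t; exact: nbhs_pinfty_gt.
by rewrite /= (linear_forB (semigS.1 t t0)) fixp.
Unshelve. all: by end_near. Qed.

End Convergence.

Unset Implicit Arguments.

Theorem theorem3p6 (R : realType) (E : completeNormedModType R)
  (L : banach_lattice E) (S : R -> E -> E) :
  C0_semigroup S -> sg_bounded S -> sg_positive L S -> sg_irreducible L S ->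
  eventually_norm_continuous S ->
  (ddim0 (ker_dual_gen S) /\ (forall f, S^~ f @ +oo --> 0))
  \/ (ddim1 (ker_dual_gen S) /\ dim1 (ker_gen S) /\
      exists u phi, quasi_interior L u /\ strictly_positive L phi /\
        forall f, S^~ f @ +oo --> phi f *: u)
  \/ (ddim1 (ker_dual_gen S) /\ dim0 (ker_gen S) /\ ~ strongly_convergent S)
  \/ (ddim_ge2 (ker_dual_gen S) /\ ~ strongly_convergent S).
Proof.
move=> C0 bndS posS irrS enc; have semigS := C0_operator_semigroup C0.
rewrite ker_dual_genE// ker_genE//.
have [d0|/existsNP[psi /not_implyP[invpsi /existsNP[f psif]]]] :=
  pselect (ddim0 (invariant_functional S)).
  by left; split=> // f; apply: (annihilated_cvg0 semigS bndS posS enc) => phi /d0.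
have [phi [invphi phi0]] := invariant_functional_pos semigS bndS posS enc invpsi psif.
right; have [d1|nd1] := pselect (ddim1 (invariant_functional S)); last first.
  right; right; split; first by have [] := ddim1_or_ge2 invpsi psif.
  by move=> /(strongly_convergent_ddim1 C0 posS irrS invphi phi0).
have [k0|/existsNP[x /not_implyP[fx x0]]] := pselect (dim0 (fixed_point S)).
  right; left; split=> //; split=> // cvgS.
  have [u [/k0 -> _]] := strongly_convergent_fixed_point C0 posS irrS invphi phi0 cvgS.
  by rewrite (linear_for0 invphi.1.1) => /esym/eqP; rewrite oner_eq0.
left; split=> //.
have [u [fu u0 phiu]] := fixed_point_normalized semigS posS irrS invphi phi0 fx x0.
have un0 : u <> 0.
  by move=> uz; have := oner_neq0 R; rewrite -phiu uz (linear_for0 invphi.1.1) eqxx.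
split.
  exists u; do 2 split=> //; move=> y fy; exists (phi y).
  exact: (fixed_span semigS posS irrS invphi phi0).
exists u, phi; split; first exact: (fixed_quasi_interior irrS).
split=> [|g]; first exact: (invariant_strictly_positive irrS invphi phi0).
exact: (ddim1_cvg_projection C0 bndS posS enc).
Qed.
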